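(* Let $n\geqslant 3$. Let $R_\mathrm{w}$ be the set of relations on the alphabet $\{a_0,b_0,e_0,f_0,c_0,d,z\}$ consisting of all relations of $R_\mathrm{s}$ together with $$c_0^2=c_0,\quad e_0c_0=c_0a_0c_0,\quad c_0f_0=c_0,\quad f_0c_0=f_0,\quad c_0d=f_0d,$$ $$c_0b_0^{n-2}a_0b_0=b_0^{n-2}a_0b_0c_0,\quad c_0b_0a_0=b_0a_0c_0,\quad c_0a_0f_0a_0=a_0f_0a_0c_0,$$ $$c_0a_0b_0^{n-2}a_0b_0e_0b_0^{n-2}a_0b_0a_0=a_0b_0^{n-2}a_0b_0e_0b_0^{n-2}a_0b_0a_0c_0,$$ $$c_0zc_0=zc_0,\quad z^2c_0=zc_0,\quad dc_0zb_0^{n-2}=a_0(b_0e_0)^{n-3}dc_0.$$ Then the presentation $\langle a_0,b_0,e_0,f_0,c_0,d,z\mid R_\mathrm{w}\rangle$ defines the monoid $\mathrm{PwEnd}(S_n)$ of all partial weak endomorphisms of the star graph $S_n$.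
   Context: Let $\Omega_{n-1}=\{1,\ldots,n-1\}$ and $\Omega_{n-1}^0=\{0,1,\ldots,n-1\}$. $\mathcal{PT}(\Omega)$ is the monoid of all partial transformations of $\Omega$; maps are written on the right and composed from left to right. $S_n$ is the star graph with vertex set $\Omega_{n-1}^0$ and edge set $\{\{0,i\}\mid 1\leqslant i\leqslant n-1\}$. For a simple graph $G=(V,E)$, $\alpha\in\mathcal{PT}(V)$ is a partial weak endomorphism if, for all $u,v\in\mathrm{Dom}(\alpha)$, $\{u,v\}\in E$ and $u\alpha\neq v\alpha$ imply $\{u\alpha,v\alpha\}\in E$; $\mathrm{PwEnd}(G)$ is the submonoid of $\mathcal{PT}(V)$ of all these. The letters stand for the following generators of $\mathrm{PwEnd}(S_n)$, elements of $\mathcal{PT}(\Omega_{n-1}^0)$: $a_0$ is the permutation swapping $1$ and $2$ and fixing all else; $b_0$ is the permutation with $0\mapsto 0$, $i\mapsto i+1$ for $1\leqslant i\leqslant n-2$, $n-1\mapsto 1$; $e_0$ is the full transformation with $2\mapsto 1$ fixing all else; $f_0$ is the partial identity with domain $\Omega_{n-1}^0\setminus\{1\}$; $c_0$ is the full transformation with $1\mapsto 0$ fixing all else; $d$ is the partial identity with domain $\Omega_{n-1}$; $z$ is the full transformation with $0\mapsto 1$ and $i\mapsto 0$ for $1\leqslant i\leqslant n-1$. $R_0$ is any fixed set of relations on the alphabet $\{a_0,b_0,e_0,f_0\}$ which defines, on the generators $a_0,b_0,e_0,f_0$, the monoid $\{\alpha\in\mathcal{PT}(\Omega_{n-1}^0)\mid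 0\in\mathrm{Dom}(\alpha),\ 0\alpha=0,\ \Omega_{n-1}\alpha\subseteq\Omega_{n-1}\}$; that is, two words over $\{a_0,b_0,e_0,f_0\}$ are congruent modulo $R_0$ if and only if they represent the same transformation. $R_\mathrm{s}$ consists of $R_0$ together with $d^2=d$, $a_0d=da_0$, $b_0d=db_0$, $e_0d=de_0$, $f_0d=df_0$, $a_0z=z$, $b_0z=z$, $e_0z=z$, $dz=zf_0$, $zd=(f_0b_0)^{n-1}z$, $z^2=(e_0b_0)^{n-3}e_0$, $d(f_0b_0)^{n-1}z=d(f_0b_0)^{n-1}$. For an alphabet $X$, $X^*$ is the free monoid on $X$; a relation $u=v$ is a pair $(u,v)\in X^*\times X^*$; $\sim_R$ is the congruence on $X^*$ generated by $R$. A monoid $M$ is defined by the presentation $\langle X\mid R\rangle$ if $M\cong X^*/{\sim_R}$.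
   Formalization: Proved for n ≥ 4 instead of n ≥ 3: at n = 3 one has a_0 = b_0, so the relation c_0b_0^{n-2}a_0b_0 = b_0^{n-2}a_0b_0c_0 says c_0a_0 = a_0c_0, which fails in PwEnd(S_3), and the presented monoid collapses to at most 5 elements. *)

(* Defs.v *)
From HB Require Import structures.
From mathcomp Require Import all_boot.
From mathcomp Require Import boolp.

Set Implicit Arguments.
Unset Strict Implicit.
Unset Printing Implicit Defensive.

Local Open Scope group_scope.
Local Open Scope quotient_scope.

Definition freeMonoid (X : Type) : Type := seq X.

Section FreeMonoid.
Variable X : choiceType.

HB.instance Definition _ := Choice.on (freeMonoid X).
HB.instance Definition _ :=
  isMonoid.Build (freeMonoid X) (@catA X) (@cat0s X) (@cats0 X).

End FreeMonoid.

Definition letterWord (X : choiceType) (x : X) : freeMonoid X := [:: x].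

Definition relations (X : choiceType) : Type :=
  freeMonoid X -> freeMonoid X -> Prop.

Section Presentation.
Variables (X : choiceType) (R : relations X).

Inductive cong : relations X :=
| cong_rel u v of R u v : cong u v
| cong_refl u : cong u u
| cong_sym u v of cong u v : cong v u
| cong_trans u v w of cong u v & cong v w : cong u w
| cong_mul u u' v v' of cong u u' & cong v v' : cong (u * v) (u' * v').

Definition congb : rel (freeMonoid X) := fun u v => `[< cong u v >].

Fact congb_refl : reflexive congb.
Proof. by move=> u; apply/asboolP/cong_refl. Qed.

Fact congb_sym : symmetric congb.
Proof. by move=> u v; apply/asboolP/asboolP => /cong_sym. Qed.

Fact congb_trans : transitive congb.
Proof.
by move=> v u w /asboolP uv /asboolP vw; apply/asboolP/(cong_trans uv vw).
Qed.

Canonical congb_equiv := EquivRel congb congb_refl congb_sym congb_trans.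

Definition presented : Type := {eq_quot congb_equiv}.

HB.instance Definition _ := Choice.on presented.
HB.instance Definition _ := EqQuotient.on presented.

Definition presentedClass (u : freeMonoid X) : presented := \pi u.

Lemma presentedClassP u v : presentedClass u = presentedClass v <-> cong u v.
Proof.
by split=> [/eqquotP/asboolP // | uv]; apply/eqquotP/asboolP.
Qed.

Definition presentedMul (p q : presented) : presented :=
  presentedClass (repr p * repr q).

Lemma presentedMulE u v :
  presentedMul (presentedClass u) (presentedClass v) = presentedClass (u * v).
Proof.
by apply/presentedClassP/cong_mul; apply/presentedClassP; rewrite /presentedClass reprK.
Qed.

Lemma presentedClass_surj p : exists u, p = presentedClass u.
Proof. by exists (repr p); rewrite /presentedClass reprK. Qed.

Fact presentedMulA : associative presentedMul.
Proof.
move=> p q r.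
have [u ->] := presentedClass_surj p.
have [v ->] := presentedClass_surj q.
have [w ->] := presentedClass_surj r.
by rewrite !presentedMulE mulgA.
Qed.

Fact presentedMul1 : left_id (presentedClass 1) presentedMul.
Proof.
by move=> p; have [u ->] := presentedClass_surj p; rewrite presentedMulE mul1g.
Qed.

Fact presented1Mul : right_id (presentedClass 1) presentedMul.
Proof.
by move=> p; have [u ->] := presentedClass_surj p; rewrite presentedMulE mulg1.
Qed.

HB.instance Definition _ :=
  isMonoid.Build presented presentedMulA presentedMul1 presented1Mul.

(* <X | R> defines M, the letter x standing for the generator g x of M. *)
Definition presentationDefines (M : monoidType) (g : X -> M) : Prop :=
  exists f : UMagmaMorphism.type presented M,
    bijective f /\ forall x, f (presentedClass (letterWord x)) = g x.

End Presentation.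

(* The partial transformation undefined at i has value None at i. *)
Definition ptrans (V : finType) : Type := {ffun V -> option V}.

Section PartialTransformations.
Variable V : finType.

HB.instance Definition _ := Finite.on (ptrans V).

Definition ptrans_one : ptrans V := [ffun v => Some v].

(* Maps act on the right: first s, then t. *)
Definition ptrans_mul (s t : ptrans V) : ptrans V := [ffun v => obind t (s v)].

Fact ptrans_mulA : associative ptrans_mul.
Proof.
by move=> s t r; apply/ffunP => v; rewrite !ffunE; case: (s v) => //= w; rewrite ffunE.
Qed.

Fact ptrans_mul1 : left_id ptrans_one ptrans_mul.
Proof. by move=> s; apply/ffunP => v; rewrite !ffunE. Qed.

Fact ptrans_1mul : right_id ptrans_one ptrans_mul.
Proof.
by move=> s; apply/ffunP => v; rewrite !ffunE; case: (s v) => //= w; rewrite ffunE.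
Qed.

HB.instance Definition _ :=
  isMonoid.Build (ptrans V) ptrans_mulA ptrans_mul1 ptrans_1mul.

End PartialTransformations.

Record sgraph (V : finType) := SGraph {
  edge :> rel V;
  edge_sym : symmetric edge;
  edge_irrefl : irreflexive edge }.

Section WeakEndomorphisms.
Variables (V : finType) (G : sgraph V).

Definition pwEndo : pred (ptrans V) := fun s =>
  [forall u, forall v, forall u', forall v',
    [&& s u == Some u', s v == Some v', G u v & u' != v'] ==> G u' v'].

Lemma pwEndoP (s : ptrans V) :
  reflect (forall u v u' v', s u = Some u' -> s v = Some v' ->
             G u v -> u' <> v' -> G u' v')
          (pwEndo s).
Proof.
apply: (iffP idP) => [H u v u' v' su sv uv /eqP ne | H].
  have /forallP/(_ u)/forallP/(_ v)/forallP/(_ u')/forallP/(_ v')/implyP := H.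
  by apply; rewrite su sv uv ne !eqxx.
apply/forallP=> u; apply/forallP=> v; apply/forallP=> u'; apply/forallP=> v'.
by apply/implyP=> /and4P[/eqP su /eqP sv uv /eqP]; apply: H su sv uv.
Qed.

Record PwEnd := MkPwEnd { pwval :> ptrans V; _ : pwEndo pwval }.

HB.instance Definition _ := [isSub for pwval].
HB.instance Definition _ := [Finite of PwEnd by <:].

Fact pwEndo_monoid_closed : monoid_closed pwEndo.
Proof.
split=> [|s t /pwEndoP Hs /pwEndoP Ht].
  by apply/pwEndoP=> u v u' v'; rewrite !ffunE => -[<-] [<-].
apply/pwEndoP=> u v u' v'; rewrite !ffunE.
case su: (s u) => [u1|//]; case sv: (s v) => [v1|//] /= tu tv uv ne.
apply: (Ht _ _ _ _ tu tv _ ne); apply: (Hs _ _ _ _ su sv uv) => u1v1.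
by apply: ne; apply: Some_inj; rewrite -tu -tv u1v1.
Qed.

HB.instance Definition _ :=
  SubChoice_isSubMonoid.Build (ptrans V) pwEndo PwEnd pwEndo_monoid_closed.

End WeakEndomorphisms.

Section Star.
Variable n : nat.

Definition starEdge : rel 'I_n := fun u v =>
  ((u == 0 :> nat) && (v != 0 :> nat)) || ((v == 0 :> nat) && (u != 0 :> nat)).

Fact starEdge_sym : symmetric starEdge.
Proof. by move=> u v; rewrite /starEdge orbC. Qed.

Fact starEdge_irrefl : irreflexive starEdge.
Proof. by move=> u; rewrite /starEdge andbN. Qed.

Definition star : sgraph 'I_n := SGraph starEdge_sym starEdge_irrefl.

(* Full transformation i |-> h i. [insub k] is k as an element of 'I_n; it is
   None only when n <= k, which occurs for none of the h below once n >= 3. *)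
Definition fullMap (h : nat -> nat) : ptrans 'I_n :=
  [ffun i : 'I_n => insub (h i)].

Definition partialId (A : pred nat) : ptrans 'I_n :=
  [ffun i : 'I_n => if A i then Some i else None].

End Star.

Inductive letter0 := A0 | B0 | E0 | F0.

Inductive letter := Old of letter0 | C0 | D | Z.
Coercion Old : letter0 >-> letter.

Section LetterStructures.

Definition letter0_code (x : letter0) : bool * bool :=
  match x with
  | A0 => (true, true) | B0 => (true, false)
  | E0 => (false, true) | F0 => (false, false)
  end.

Definition letter0_decode (p : bool * bool) : letter0 :=
  match p with
  | (true, true) => A0 | (true, false) => B0
  | (false, true) => E0 | (false, false) => F0
  end.

Fact letter0_codeK : cancel letter0_code letter0_decode.
Proof. by case. Qed.

HB.instance Definition _ := Finite.copy letter0 (can_type letter0_codeK).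

Definition letter_code (x : letter) : letter0 + option bool :=
  match x with
  | Old y => inl y | C0 => inr None | D => inr (Some true) | Z => inr (Some false)
  end.

Definition letter_decode (p : letter0 + option bool) : letter :=
  match p with
  | inl y => Old y | inr None => C0 | inr (Some true) => D | inr (Some false) => Z
  end.

Fact letter_codeK : cancel letter_code letter_decode.
Proof. by case. Qed.

HB.instance Definition _ := Finite.copy letter (can_type letter_codeK).

End LetterStructures.

Definition genTrans0 (n : nat) (x : letter0) : ptrans 'I_n :=
  match x with
  | A0 => fullMap n [fun i : nat => i with 1%N |-> 2, 2 |-> 1%N]
  | B0 => fullMap n (fun i => if i == 0 then 0
                              else if i == n.-1 then 1%N else i.+1)
  | E0 => fullMap n [fun i : nat => i with 2 |-> 1%N]
  | F0 => partialId n (predC1 1%N)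
  end.

Definition genTrans (n : nat) (x : letter) : ptrans 'I_n :=
  match x with
  | Old y => genTrans0 n y
  | C0 => fullMap n [fun i : nat => i with 1%N |-> 0]
  | D => partialId n (predC1 0)
  | Z => fullMap n (fun i => if i == 0 then 1%N else 0)
  end.

Fact genTrans_pwEndo n x : pwEndo (star n) (genTrans n x).
Proof.
have full h : (forall i j : nat, i = 0 -> j != 0 -> h i != h j ->
                 (h i == 0) (+) (h j == 0)) -> pwEndo (star n) (fullMap n h).
  move=> H; apply/pwEndoP=> u v u' v'; rewrite !ffunE.
  case: insubP => // i _ iu [<-]; case: insubP => // j _ jv [<-] uv ne.
  have {}ne : h u != h v by apply/eqP; rewrite -iu -jv => /val_inj.
  rewrite /= /starEdge iu jv.
  case/orP: uv => /andP[/eqP u0 v0].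
    by have := H u v u0 v0 ne; case: (h u == 0); case: (h v == 0).
  have := H v u u0 v0; rewrite eq_sym => /(_ ne).
  by case: (h u == 0); case: (h v == 0).
have pid A : pwEndo (star n) (partialId n A).
  apply/pwEndoP=> u v u' v'; rewrite !ffunE.
  by case: (A u) => // -[<-]; case: (A v) => // -[<-].
case: x => [[]|||] //=; apply: full => _ j -> j0 /=.
- by case: j j0 => [|[|[|]]].
- by rewrite (negbTE j0); case: (j == _).
- by case: j j0 => [|[|[|]]].
- by case: j j0 => [|[|]].
- by rewrite (negbTE j0).
Qed.

Definition genPwEnd (n : nat) (x : letter) : PwEnd (star n) :=
  MkPwEnd (genTrans_pwEndo n x).

(* The transformation of 'I_n represented by a word on a_0, b_0, e_0, f_0. *)
Definition eval0 (n : nat) (w : freeMonoid letter0) : ptrans 'I_n :=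
  \prod_(x <- w) genTrans0 n x.

Local Notation a := (letterWord (Old A0)).
Local Notation b := (letterWord (Old B0)).
Local Notation e := (letterWord (Old E0)).
Local Notation f := (letterWord (Old F0)).
Local Notation c := (letterWord C0).
Local Notation d := (letterWord D).
Local Notation z := (letterWord Z).

Section Relations.
Variables (n : nat) (R0 : relations letter0).

Inductive Rs : relations letter :=
| Rs_R0 u v of R0 u v : Rs (map Old u) (map Old v)
| Rs_dd : Rs (d ^+ 2) d
| Rs_ad : Rs (a * d) (d * a)
| Rs_bd : Rs (b * d) (d * b)
| Rs_ed : Rs (e * d) (d * e)
| Rs_fd : Rs (f * d) (d * f)
| Rs_az : Rs (a * z) z
| Rs_bz : Rs (b * z) z
| Rs_ez : Rs (e * z) z
| Rs_dz : Rs (d * z) (z * f)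
| Rs_zd : Rs (z * d) ((f * b) ^+ n.-1 * z)
| Rs_zz : Rs (z ^+ 2) ((e * b) ^+ (n - 3) * e)
| Rs_dfbz : Rs (d * (f * b) ^+ n.-1 * z) (d * (f * b) ^+ n.-1).

Inductive Rw : relations letter :=
| Rw_Rs u v of Rs u v : Rw u v
| Rw_cc : Rw (c ^+ 2) c
| Rw_ec : Rw (e * c) (c * a * c)
| Rw_cf : Rw (c * f) c
| Rw_fc : Rw (f * c) f
| Rw_cd : Rw (c * d) (f * d)
| Rw_cbab : Rw (c * b ^+ (n - 2) * a * b) (b ^+ (n - 2) * a * b * c)
| Rw_cba : Rw (c * b * a) (b * a * c)
| Rw_cafa : Rw (c * a * f * a) (a * f * a * c)
| Rw_cabab :
    Rw (c * a * b ^+ (n - 2) * a * b * e * b ^+ (n - 2) * a * b * a)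
       (a * b ^+ (n - 2) * a * b * e * b ^+ (n - 2) * a * b * a * c)
| Rw_czc : Rw (c * z * c) (z * c)
| Rw_zzc : Rw (z ^+ 2 * c) (z * c)
| Rw_dczb : Rw (d * c * z * b ^+ (n - 2)) (a * (b * e) ^+ (n - 3) * d * c).

End Relations.

(* Main.v *)
(* Identify the leaves with V = {1,...,n-1}.  The letters a_0, b_0, e_0, f_0
   generate PT(V), so R_0 embeds PT(V) in the presented monoid M.  Write c_i for
   the conjugate of c_0 by the transposition (1 i).  The relations say that c_0
   commutes with all maps fixing the leaf 1 and sending no other leaf to it, that
   c_i f_i = c_i, f_i c_i = f_i, and that e_0 c_0 is governed by c_1 c_2; hence the
   c_i are commuting idempotents, and their products c_A (A a set of leaves)
   satisfy g c_A = c_{g^-1(A)} g for every g in PT(V).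
   A partial weak endomorphism either fixes the centre, or is undefined there, or
   sends it to a leaf k and every leaf of its domain to the centre or to k.
   Accordingly it is represented by c_A g, by d c_A g, or by f_U c_K z const_k,
   where A and K are the preimages of the centre and of k, and U is the set of
   leaves off the domain.  Modulo the relations these normal forms are stable
   under right multiplication by the generators, so every word equals the normal
   form of the transformation it represents. *)
From HB Require Import structures.
From mathcomp Require Import all_boot all_fingroup zify.
Require Import Defs.

Set Implicit Arguments.
Unset Strict Implicit.
Unset Printing Implicit Defensive.

Local Open Scope group_scope.

(** * Partial transformations and generation *)

Section PartialMaps.
Variable V : finType.
Implicit Types (g h : ptrans V) (i j k x y : V) (A B U : {set V}).

Definition pperm (p : {perm V}) : ptrans V := [ffun x => Some (p x)].
Definition pcollapse i j : ptrans V :=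
  [ffun x => Some (if x == i then j else x)].
Definition prestrict U : ptrans V :=
  [ffun x => if x \in U then None else Some x].
Definition pconst A i : ptrans V :=
  [ffun x => if x \in A then Some i else None].
Definition ppre g A : {set V} := [set x | oapp (mem A) false (g x)].

Lemma pmulE g h x : (g * h) x = obind h (g x).
Proof. by rewrite ffunE. Qed.

Lemma ponE x : (1 : ptrans V) x = Some x.
Proof. by rewrite ffunE. Qed.

Lemma ppermM p q : pperm (p * q) = pperm p * pperm q.
Proof. by apply/ffunP=> x; rewrite !ffunE /= ffunE permM. Qed.

Lemma pperm1 : pperm 1 = 1.
Proof. by apply/ffunP=> x; rewrite !ffunE perm1. Qed.

Lemma ppermK p : pperm p * pperm p^-1 = 1.
Proof. by rewrite -ppermM mulgV pperm1. Qed.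

Lemma ppermVK p : pperm p^-1 * pperm p = 1.
Proof. by rewrite -ppermM mulVg pperm1. Qed.

Lemma pperm_tpermK i j : pperm (tperm i j) * pperm (tperm i j) = 1.
Proof. by rewrite -ppermM tperm2 pperm1. Qed.

Lemma ppermX (p : {perm V}) (n : nat) : pperm (p ^+ n) = pperm p ^+ n.
Proof. by elim: n => [|n IH]; rewrite ?pperm1 // !expgS ppermM IH. Qed.

Lemma pcollapseJ (p : {perm V}) i j :
  pperm p^-1 * pcollapse i j * pperm p = pcollapse (p i) (p j).
Proof.
apply/ffunP=> x; rewrite !ffunE /= ffunE /= ffunE; congr Some.
by rewrite (canF_eq (permKV p)); case: eqP => // _; rewrite permKV.
Qed.

Lemma prestrictJ (p : {perm V}) i :
  pperm p^-1 * prestrict [set i] * pperm p = prestrict [set p i].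
Proof.
apply/ffunP=> x; rewrite !ffunE /= ffunE /= !inE (canF_eq (permKV p)).
by case: eqP => //= _; rewrite ffunE permKV.
Qed.

(** By induction on the number of points that [g] does not fix. Let [i] be one. If [g] is undefined
    at [i], split off the restriction at [i]; if [g] sends [i] to a fixed point [k], split off the
    collapse of [i] to [k]; otherwise split off the transposition of [i] and [k]. The remaining
    factor fixes more points and still preserves [S]. *)
Lemma pmul_closed_gen (S : {set V}) (Q : ptrans V -> Prop) :
    Q 1 -> (forall g h, Q g -> Q h -> Q (g * h)) ->
    {in S &, forall i j, Q (pperm (tperm i j))} ->
    {in S &, forall i j, i != j -> Q (pcollapse i j)} ->
    {in S, forall i, Q (prestrict [set i])} ->
  forall g, (forall x, x \notin S -> g x = Some x) ->
    (forall x y, x \in S -> g x = Some y -> y \in S) -> Q g.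
Proof.
move=> Q1 QM Qt Qe Qf g.
have [m] := ubnP #|[set x | g x != Some x]|.
elim: m g => // m IH g lem gout gin.
have [/pred0P g1|] := boolP (pred0b [pred x | g x != Some x]).
  suff -> : g = 1 by [].
  by apply/ffunP=> x; rewrite ffunE; apply/eqP/negPn/negbT/(g1 x).
case/pred0Pn=> i /= gi.
have iS : i \in S by apply: contraR gi => /gout ->.
have step h j : g j != Some j -> h j = Some j ->
    (forall x, h x != Some x -> g x != Some x) ->
    (forall x, x \notin S -> h x = Some x) ->
    (forall x y, x \in S -> h x = Some y -> y \in S) -> Q h.
  move=> gj hj hg; apply: IH; rewrite -ltnS; apply: leq_trans lem.
  rewrite ltnS; apply/proper_card/properP.
  split; first by apply/subsetP=> x; rewrite !inE; apply: hg.
  by exists j; rewrite inE // hj eqxx.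
pose h := [ffun x => if x == i then Some i else g x] : ptrans V.
have Qh : Q h.
  apply: (step h i gi); rewrite ?ffunE ?eqxx // => x; rewrite ffunE.
  - by case: (x =P i) => [->|//]; rewrite eqxx.
  - by case: (x =P i) => [-> /negP//|_ /gout].
  - by move=> y; case: (x =P i) => [-> _ [<-]|_ xS /gin -> //].
case gik: (g i) => [k|]; last first.
  suff -> : g = prestrict [set i] * h by apply: QM => //; apply: Qf.
  apply/ffunP=> x; rewrite !ffunE in_set1; case: (x =P i) => [->|/eqP xi] //=.
  by rewrite ffunE (negbTE xi).
have kS : k \in S := gin _ _ iS gik.
have ik : i != k by apply: contra gi => /eqP {2}->; rewrite gik.
case: (g k =P Some k) => [gk|/eqP gk].
  suff -> : g = pcollapse i k * h by apply: QM => //; apply: Qe.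
  apply/ffunP=> x; rewrite !ffunE /= ffunE; case: (x =P i) => [->|/eqP xi] /=.
    by rewrite eq_sym (negbTE ik) gk.
  by rewrite (negbTE xi).
pose h' := [ffun x => if x == k then Some k else
                      if x == i then g k else g x] : ptrans V.
suff Qh' : Q h'.
  suff -> : g = pperm (tperm i k) * h' by apply: QM => //; apply: Qt.
  apply/ffunP=> x; rewrite !ffunE /= ffunE.
  case: tpermP => [->|->|/eqP xi /eqP xk]; rewrite ?eqxx ?(negbTE ik) //.
  by rewrite (negbTE xi) (negbTE xk).
apply: (step h' k gk); rewrite ?ffunE ?eqxx // => x; rewrite ffunE.
- by case: (x =P k) => [->|_]; [rewrite eqxx | case: (x =P i) => [->|//]].
- case: (x =P k) => [->|_ xS]; first by rewrite kS.
  by case: (x =P i) => [xi|_]; [rewrite -xi (negbTE xS) in iS | apply: gout].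
- move=> y; case: (x =P k) => [_ _ [<-] //|_].
  by case: (x =P i) => [_ _|_]; apply: gin.
Qed.

(* The transpositions on [S] move the given collapse and restriction to any
   other position. *)
Lemma pmul_closed_genJ (S : {set V}) (Q : ptrans V -> Prop) o o' :
    o \in S -> o' \in S -> o != o' ->
    Q 1 -> (forall g h, Q g -> Q h -> Q (g * h)) ->
    {in S &, forall i j, Q (pperm (tperm i j))} ->
    Q (pcollapse o' o) -> Q (prestrict [set o]) ->
  forall g, (forall x, x \notin S -> g x = Some x) ->
    (forall x y, x \in S -> g x = Some y -> y \in S) -> Q g.
Proof.
move=> oS o'S oo' Q1 QM Qt Qe Qf; apply: (pmul_closed_gen Q1 QM Qt).
(* [k] is where the first transposition puts [o], so [p] takes [o'] to [i] and [o] to [j]. *)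
- move=> i j iS jS ij; pose k := tperm o' i o; pose p := tperm o' i * tperm k j.
  have kS : k \in S by rewrite /k; case: tpermP.
  have ki : k != i by rewrite /k -{2}(tpermL o' i) (inj_eq perm_inj).
  have -> : i = p o' by rewrite permM tpermL tpermD // eq_sym.
  have -> : j = p o by rewrite permM -/k tpermL.
  rewrite -pcollapseJ /p invMg !tpermV !ppermM.
  by apply: (QM _ _ (QM _ _ (QM _ _ _ _) Qe) (QM _ _ _ _)); apply: (Qt).
- move=> i iS; rewrite -(tpermL o i) -prestrictJ tpermV.
  by apply: (QM _ _ (QM _ _ _ Qf)); apply: (Qt).
Qed.

(** * Preimages and restrictions *)

Lemma ppre1 A : ppre 1 A = A.
Proof. by apply/setP=> x; rewrite inE ponE. Qed.

Lemma ppreM g h A : ppre (g * h) A = ppre g (ppre h A).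
Proof. by apply/setP=> x; rewrite !inE pmulE; case: (g x) => //= y; rewrite inE. Qed.

Lemma ppreU g A B : ppre g (A :|: B) = ppre g A :|: ppre g B.
Proof. by apply/setP=> x; rewrite !inE; case: (g x) => //= y; rewrite inE. Qed.

Lemma ppre_restrict U A : ppre (prestrict U) A = A :\: U.
Proof. by apply/setP=> x; rewrite !inE ffunE; case: (x \in U). Qed.

Lemma prestrictM A B : prestrict A * prestrict B = prestrict (A :|: B).
Proof.
by apply/ffunP=> x; rewrite !ffunE inE; case: (x \in A) => //=; rewrite ffunE.
Qed.

Lemma prestrict0 : prestrict set0 = 1.
Proof. by apply/ffunP=> x; rewrite !ffunE inE. Qed.

End PartialMaps.

(** * Normal forms over an abstract monoid *)

Section NormalForm.
Variables (V : finType) (p1 p2 : V) (p12 : p1 != p2).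
Implicit Types (g h : ptrans V) (i j k x y : V) (A B U : {set V}) (s t : seq V).

(** In the application [M] is the presented monoid, [iota] sends a map of the leaves to the class of
    a word for it, and [p1], [p2] are the leaves 1 and 2. The hypotheses are the relations in the
    form in which they are used. *)
Variables (M : monoidType) (iota : ptrans V -> M) (c d z : M).
Hypothesis iota1 : iota 1 = 1.
Hypothesis iotaM : forall g h, iota (g * h) = iota g * iota h.
Local Notation f := (prestrict [set p1]).
Hypothesis c_stab : forall g, g p1 = Some p1 ->
  (forall x, g x = Some p1 -> x = p1) -> iota g * c = c * iota g.
Hypothesis ec : iota (pcollapse p2 p1) * c = c * iota (pperm (tperm p1 p2)) * c.
Hypothesis cc : c * c = c.
Hypothesis cf : c * iota f = c.
Hypothesis fc : iota f * c = iota f.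
Hypothesis cd : c * d = iota f * d.
Hypothesis dd : d * d = d.
Hypothesis gd : forall g, iota g * d = d * iota g.
Hypothesis kz : iota (pconst setT p1) * z = z.
Hypothesis zz : z * z = iota (pconst setT p1).
Hypothesis dz : d * z = z * iota f.
Hypothesis zd : z * d = iota (prestrict setT) * z.
Hypothesis zzc : z * z * c = z * c.
(** The last relation of R_w, solved for [d * c * z]: [p3] is the last leaf, [h0] is
    a_0(b_0e_0)^{n-3} and [r0] is b_0. *)
Variables (p3 : V) (h0 r0 : ptrans V).
Hypothesis p13 : p1 != p3.
Hypothesis h0p1 : h0 p1 = Some p3.
Hypothesis h0D : forall x, x != p1 -> h0 x = Some p1.
Hypothesis r0p3 : r0 p3 = Some p1.
Hypothesis dcz : d * c * z = iota h0 * d * c * iota r0.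

(* The element c_i of the proof idea *)
Definition cpt i : M :=
  iota (pperm (tperm p1 i)) * c * iota (pperm (tperm p1 i)).

(** * The idempotents c_i and their commutation *)

Lemma iota_tpermK i j : iota (pperm (tperm i j)) * iota (pperm (tperm i j)) = 1.
Proof. by rewrite -iotaM pperm_tpermK. Qed.

Lemma cpt1 : cpt p1 = c.
Proof. by rewrite /cpt tperm1 pperm1 iota1 mul1g mulg1. Qed.

(** Put the transposition of [p1] and [j] before [g] and that of [p1] and [i] after it: the result
    fixes [p1] and sends nothing else there, so [c_stab] applies. *)
Lemma iota_cpt g i j : (forall x, (g x == Some i) = (x == j)) ->
  iota g * cpt i = cpt j * iota g.
Proof.
move=> gij; rewrite /cpt.
set u := pperm (tperm p1 i); set v := pperm (tperm p1 j).
have vv : v * v = 1 by apply: pperm_tpermK.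
have uu : u * u = 1 by apply: pperm_tpermK.
have st : iota (v * g * u) * c = c * iota (v * g * u).
  have E x : (v * g * u) x = omap (tperm p1 i) (g (tperm p1 j x)).
    by rewrite !pmulE ffunE /=; case: (g _) => //= y; rewrite ffunE.
  have gj : g j = Some i by apply/eqP; rewrite gij.
  apply: c_stab => [|x]; rewrite E; first by rewrite tpermL gj /= tpermR.
  case gx: (g _) => [y|] //= -[yp1].
  have {}yp1 : y = i by rewrite -(tpermL p1 i) -{2}yp1 tpermK.
  move/eqP: gx; rewrite yp1 gij => /eqP.
  by rewrite -{2}(tpermL p1 j) => /perm_inj.
have -> : iota g * (iota u * c * iota u) = iota v * (iota (v * g * u) * c) * iota u.
  by rewrite !iotaM !mulgA -[iota v * iota v]iotaM vv iota1 mul1g.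
rewrite st !iotaM -!mulgA -[iota u * iota u]iotaM uu iota1.
by rewrite mulg1 !mulgA.
Qed.

Lemma tp_restrictl i : pperm (tperm p1 i) * f = prestrict [set i] * pperm (tperm p1 i).
Proof.
have := prestrictJ (tperm p1 i) p1; rewrite tpermL tpermV => <-.
by rewrite -mulgA pperm_tpermK mulg1.
Qed.

Lemma tp_restrictr i : pperm (tperm p1 i) * prestrict [set i] = f * pperm (tperm p1 i).
Proof.
have := prestrictJ (tperm p1 i) i; rewrite tpermR tpermV => <-.
by rewrite -mulgA pperm_tpermK mulg1.
Qed.

Lemma cpt_restrict i : cpt i * iota (prestrict [set i]) = cpt i.
Proof.
by rewrite /cpt -[_ * iota (prestrict _)]mulgA -iotaM tp_restrictr iotaM mulgA -(mulgA _ c) cf.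
Qed.

Lemma restrict_cpt i : iota (prestrict [set i]) * cpt i = iota (prestrict [set i]).
Proof.
rewrite /cpt !mulgA -iotaM -tp_restrictl iotaM -(mulgA _ (iota f) c) fc.
by rewrite -!iotaM tp_restrictl -mulgA pperm_tpermK mulg1.
Qed.

Lemma cptK i : cpt i * cpt i = cpt i.
Proof.
rewrite /cpt -!mulgA (mulgA (iota (pperm _)) (iota (pperm _))) iota_tpermK mul1g.
by rewrite (mulgA c c) cc.
Qed.

Lemma cptd i : cpt i * d = iota (prestrict [set i]) * d.
Proof.
rewrite /cpt -mulgA (gd (pperm _)) -!mulgA (mulgA c) cd -mulgA -gd !mulgA -!iotaM.
by rewrite tp_restrictl -[_ * _ * pperm _]mulgA pperm_tpermK mulg1.
Qed.

(** As [g] misses [i], it may be followed by the restriction away from [i], which absorbs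
    [cpt i]. *)
Lemma iota_cpt0 g i : (forall x, g x != Some i) -> iota g * cpt i = iota g.
Proof.
move=> gi; suff -> : g = g * prestrict [set i].
  by rewrite iotaM -mulgA restrict_cpt.
apply/ffunP=> x; rewrite pmulE; have := gi x; case: (g x) => //= y.
by rewrite (inj_eq (@Some_inj _)) ffunE inE => /negbTE->.
Qed.

(** Both products of [cpt p1] and [cpt p2] equal [iota e * c]. The relation [ec] gives c_1c_2 = e c
    a and c_2c_1 = a e c, where a e = e; moreover e c absorbs the restriction away from [p1] and
    [p2], so a factor a or e on its right disappears. *)
Lemma cpt12 : iota (pcollapse p2 p1) * c = cpt p1 * cpt p2 * iota (pcollapse p2 p1)
  /\ cpt p1 * cpt p2 = cpt p2 * cpt p1.
Proof.
set a := pperm (tperm p1 p2); set e := pcollapse p2 p1.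
have aa : iota a * iota a = 1 by apply: iota_tpermK.
have ae : a * e = e.
  apply/ffunP=> x; rewrite pmulE ffunE /= !ffunE.
  by case: tpermP => [->|->|_ _]; rewrite ?eqxx ?(negbTE p12).
have c12 : cpt p1 * cpt p2 = iota e * c * iota a.
  by rewrite cpt1 /cpt -/a !mulgA ec.
have c21 : cpt p2 * cpt p1 = iota e * c.
  by rewrite cpt1 /cpt -/a -!mulgA (mulgA c) -ec mulgA -iotaM ae.
(* The map e misses [p2], so e = e f_2; then f_2 commutes with c, and c = c f_1. *)
have ecf : iota e * c = iota e * c * iota (prestrict [set p1; p2]).
  have fp2 : iota (prestrict [set p2]) * c = c * iota (prestrict [set p2]).
    apply: c_stab => [|x]; rewrite ffunE inE ?(negbTE p12) //.
    by case: ifP => // _ [].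
  have -> : iota e * c = iota e * iota (prestrict [set p2]) * c.
    rewrite -iotaM; congr (iota _ * c); apply/ffunP=> x; rewrite pmulE ffunE /=.
    by rewrite ffunE inE; case: (x =P p2) => [_|/eqP/negbTE->]; rewrite ?(negbTE p12).
  rewrite -[iota e * _ * c]mulgA fp2 -{1}cf -!mulgA -!iotaM.
  by rewrite !prestrictM [_ :|: [set p1; p2]]setUC -setUA setUid.
have fa : prestrict [set p1; p2] * a = prestrict [set p1; p2].
  apply/ffunP=> x; rewrite pmulE ffunE !inE; case: (x =P p1) => //= /eqP xp1.
  by case: (x =P p2) => //= /eqP xp2; rewrite ffunE tpermD // eq_sym.
have fe : prestrict [set p1; p2] * e = prestrict [set p1; p2].
  apply/ffunP=> x; rewrite pmulE ffunE !inE; case: (x =P p1) => //= /eqP xp1.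
  by case: (x =P p2) => //= /eqP xp2; rewrite ffunE (negbTE xp2).
have eca : iota e * c * iota a = iota e * c.
  by rewrite ecf -mulgA -iotaM fa.
split; last by rewrite c12 c21.
by rewrite c12 eca {2}ecf -[RHS]mulgA -iotaM fe -ecf.
Qed.

Lemma iota_cpt_perm (p : {perm V}) i :
  iota (pperm p) * cpt (p i) = cpt i * iota (pperm p).
Proof.
by apply: iota_cpt => x; rewrite ffunE (inj_eq (@Some_inj _)) (inj_eq perm_inj).
Qed.

Lemma cptC i j : cpt i * cpt j = cpt j * cpt i.
Proof.
have [->//|ij] := eqVneq i j.
(* [p] takes [p1] to [i] and [p2] to [j]; conjugation by it transports [cpt12]. *)
pose q := tperm (tperm p1 i p2) j; pose p := tperm p1 i * q.
have pi : i = p p1.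
  rewrite permM tpermL tpermD 1?eq_sym // -{1}(tpermL p1 i).
  by rewrite (inj_eq perm_inj).
have pj : j = p p2 by rewrite permM tpermL.
have E x y : cpt (p x) * cpt (p y) = iota (pperm p^-1) * (cpt x * cpt y) * iota (pperm p).
  rewrite -[RHS]mulgA -(mulgA (cpt x)) -iota_cpt_perm (mulgA (cpt x)) -iota_cpt_perm.
  by rewrite !mulgA -iotaM ppermVK iota1 mul1g.
by rewrite pi pj !E (cpt12).2.
Qed.

(** * Products c_A over sets of leaves *)

Definition cseq s : M := \prod_(i <- s) cpt i.
Definition cset A : M := cseq (enum A).

Lemma cseq_cons i s : cseq (i :: s) = cpt i * cseq s.
Proof. by rewrite /cseq big_cons. Qed.

Lemma cseq_cat s t : cseq (s ++ t) = cseq s * cseq t.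
Proof. by rewrite /cseq big_cat. Qed.

Lemma cpt_cseqC i s : cpt i * cseq s = cseq s * cpt i.
Proof.
elim: s => [|j s IH]; first by rewrite /cseq big_nil mul1g mulg1.
by rewrite cseq_cons mulgA cptC -mulgA IH mulgA.
Qed.

Lemma cseqC s t : cseq s * cseq t = cseq t * cseq s.
Proof.
elim: s => [|j s IH]; first by rewrite /cseq big_nil mul1g mulg1.
by rewrite cseq_cons -mulgA IH mulgA (cpt_cseqC j t) !mulgA.
Qed.

Lemma cseq_sub s t : {subset s <= t} -> cseq s * cseq t = cseq t.
Proof.
have one i r : i \in r -> cpt i * cseq r = cseq r.
  elim: r => // j r IH; rewrite inE cseq_cons mulgA => /orP[/eqP<-|/IH ir].
    by rewrite cptK.
  by rewrite cptC -mulgA ir.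
elim: s => [|i s IH] st; first by rewrite /cseq big_nil mul1g.
rewrite cseq_cons -mulgA IH ?one ?st ?mem_head // => x xs.
by rewrite st // inE xs orbT.
Qed.

(** Commuting idempotents: neither order nor repetition matters. Hence [cset] is multiplicative on
    unions. *)
Lemma eq_cseq s t : s =i t -> cseq s = cseq t.
Proof.
move=> st; rewrite -(@cseq_sub t s) => [|x]; last by rewrite st.
by rewrite cseqC cseq_sub // => x; rewrite st.
Qed.

Lemma cset0 : cset set0 = 1.
Proof. by rewrite /cset enum_set0 /cseq big_nil. Qed.

Lemma cset1 i : cset [set i] = cpt i.
Proof. by rewrite /cset enum_set1 /cseq big_seq1. Qed.

Lemma csetU A B : cset (A :|: B) = cset A * cset B.
Proof.
rewrite /cset -cseq_cat; apply: eq_cseq => x.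
by rewrite mem_cat !mem_enum inE.
Qed.

Lemma cset_ind (Q : {set V} -> Prop) :
  Q set0 -> (forall i A, Q A -> Q (i |: A)) -> forall A, Q A.
Proof.
move=> Q0 QU A; have [m] := ubnP #|A|; elim: m A => // m IH A lem.
have [->//|[i iA]] := set_0Vmem A.
rewrite -(setD1K iA); apply/QU/IH; rewrite -ltnS; apply: leq_trans lem.
by rewrite ltnS [ltnRHS](cardsD1 i) iA.
Qed.

(** The property is closed under products of maps, so transpositions, one collapse and one
    restriction suffice; preimages respect unions, so for these it is enough to treat singletons. A
    point with one preimage falls under [iota_cpt], a point with none under [iota_cpt0]. *)
Lemma iota_cset g A : iota g * cset A = cset (ppre g A) * iota g.
Proof.
pose Q g := forall A, iota g * cset A = cset (ppre g A) * iota g.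
have Qi h : (forall i, iota h * cpt i = cset (ppre h [set i]) * iota h) -> Q h.
  move=> Hi; elim/cset_ind => [|i B IH].
    have -> : ppre h set0 = set0.
      by apply/setP=> x; rewrite !inE; case: (h x) => //= y; rewrite inE.
    by rewrite cset0 mul1g mulg1.
  by rewrite ppreU !csetU cset1 mulgA Hi -mulgA IH mulgA.
have single h i j : (forall x, (h x == Some i) = (x == j)) ->
    iota h * cpt i = cset (ppre h [set i]) * iota h.
  move=> hij; suff -> : ppre h [set i] = [set j] by rewrite cset1 (iota_cpt hij).
  by apply/setP=> x; rewrite !inE -hij; case: (h x) => //= y; rewrite inE.
have none h i : (forall x, h x != Some i) ->
    iota h * cpt i = cset (ppre h [set i]) * iota h.
  move=> hi; suff -> : ppre h [set i] = set0 by rewrite cset0 mul1g iota_cpt0.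
  apply/setP=> x; rewrite !inE; have := hi x; case: (h x) => //= y.
  by rewrite inE; apply: contraNF => /eqP->.
suff : Q g by apply.
apply: (@pmul_closed_genJ _ setT Q p1 p2); rewrite ?inE //.
- by move=> B; rewrite ppre1 iota1 mul1g mulg1.
- by move=> g' h Qg Qh B; rewrite iotaM ppreM -mulgA Qh mulgA Qg mulgA.
- move=> i j _ _; apply: Qi => k.
  apply: (single _ _ (tperm i j k)) => x; rewrite ffunE (inj_eq (@Some_inj _)).
  by rewrite (canF_eq (tpermK i j)).
(* Under the collapse [p1] is the only point with two preimages, which is the case of [cpt12]; [p2]
   has none. *)
- apply: Qi => k; have [->|kp1] := eqVneq k p1.
    rewrite cpt1 (cpt12).1 -!cset1 -csetU; congr (cset _ * _).
    apply/setP=> x; rewrite !inE ffunE /= inE.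
    by case: (x =P p2) => [->|]; rewrite ?eqxx ?orbT ?orbF.
  have [->|kp2] := eqVneq k p2.
    apply: none => x; rewrite ffunE (inj_eq (@Some_inj _)).
    by case: (x =P p2) => [_|/eqP//].
  apply: (single _ _ k) => x; rewrite ffunE (inj_eq (@Some_inj _)).
  by case: (x =P p2) => // ->; rewrite ![_ == k]eq_sym (negbTE kp1) (negbTE kp2).
- apply: Qi => k; have [->|kp1] := eqVneq k p1.
    by apply: none => x; rewrite ffunE inE; case: (x =P p1) => [|xp] //; apply/eqP=> -[].
  apply: (single _ _ k) => x; rewrite ffunE inE.
  by case: (x =P p1) => [->|_] //; rewrite [RHS]eq_sym (negbTE kp1).
by move=> x; rewrite inE.
Qed.

Lemma cset_restrict A : cset A * iota (prestrict A) = cset A.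
Proof.
move: A; apply: cset_ind => [|i A IH]; first by rewrite prestrict0 iota1 mulg1.
rewrite {1}csetU cset1 -prestrictM iotaM /cset cpt_cseqC -mulgA (mulgA (cpt i)).
by rewrite cpt_restrict mulgA -cpt_cseqC -mulgA IH -/(cset (i |: A)) csetU cset1.
Qed.

(** [cset A] absorbs the restriction away from [A], so what follows it is only seen off [A]. *)
Lemma cset_eq A g h : (forall x, x \notin A -> g x = h x) ->
  cset A * iota g = cset A * iota h.
Proof.
move=> gh; rewrite -cset_restrict -!mulgA -!iotaM; congr (_ * iota _).
apply/ffunP=> x; rewrite !pmulE ffunE; case: ifPn => //= xA; exact: gh.
Qed.

Lemma csetT g : cset setT * iota g = cset setT.
Proof. by rewrite (@cset_eq _ _ 1) ?iota1 ?mulg1 // => x; rewrite inE. Qed.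

Lemma csetd A : cset A * d = iota (prestrict A) * d.
Proof.
move: A; apply: cset_ind => [|i A IH]; first by rewrite prestrict0 iota1 cset0.
rewrite csetU -mulgA IH gd mulgA cset1 cptd -mulgA -gd mulgA -iotaM.
by rewrite prestrictM.
Qed.

(** * Leaf maps and products c_A next to z *)

Lemma full_z g : (forall x, g x != None) -> iota g * z = z.
Proof.
move=> gT; rewrite -{1}kz mulgA -iotaM; suff -> : g * pconst setT p1 = pconst setT p1 by [].
by apply/ffunP=> x; rewrite pmulE; have := gT x; case: (g x) => // y _ /=; rewrite !ffunE !inE.
Qed.

(** Filling the undefined points of [g] with the identity gives a full map [h], which [z] absorbs;
    [g] is the restriction to its domain followed by [h]. *)
Lemma iota_z g : iota g * z = iota (prestrict [set x | g x == None]) * z.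
Proof.
pose h := [ffun x => Some (odflt x (g x))] : ptrans V.
rewrite -[in RHS](@full_z h) => [|x]; last by rewrite ffunE.
rewrite mulgA -iotaM; congr (iota _ * z); apply/ffunP=> x; rewrite pmulE ffunE inE.
by case gx: (g x) => //=; rewrite ffunE gx.
Qed.

Lemma z_const : z * iota (pconst setT p1) = z.
Proof. by rewrite -zz mulgA zz kz. Qed.

(** By [z_const] the constant map to [p1] may be inserted after [z], so the next leaf map is only
    seen at [p1]. *)
Lemma z_iota g h : g p1 = h p1 -> z * iota g = z * iota h.
Proof.
move=> gh; rewrite -z_const -!mulgA -!iotaM; congr (_ * iota _).
by apply/ffunP=> x; rewrite !pmulE ffunE inE.
Qed.

(** Replace z c by z z c, that is, by the constant map followed by c, and move c to the left: the
    preimage of [p1] is everything. *)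
Lemma zc : z * c = cset setT.
Proof.
rewrite -zzc zz -cpt1 -cset1 iota_cset.
have -> : ppre (pconst setT p1) [set p1] = setT; last exact: csetT.
by apply/setP=> x; rewrite !inE ffunE inE /= inE eqxx.
Qed.

(** For the singleton of [p1] this is the relation [dcz]. The general case is pulled back along a
    full map [h] taking [A] to [p1] and the other leaves to [p2]: it is absorbed by [z], commutes
    with [d] and passes [cset] by preimages. *)
Lemma dcset_z A : d * cset A * z = d * cset (~: A) * iota (pconst A p1).
Proof.
have dcz1 : d * cset [set p1] * z = d * cset (~: [set p1]) * iota (pconst [set p1] p1).
  rewrite cset1 cpt1 dcz gd -(mulgA d) -cpt1 -cset1 iota_cset -!mulgA -iotaM.
  congr (d * _); have -> : ppre h0 [set p1] = ~: [set p1].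
    apply/setP=> x; rewrite !inE; have [->|xp1] := eqVneq x p1.
      by rewrite h0p1 /= inE eq_sym (negbTE p13).
    by rewrite h0D //= inE eqxx.
  (* Only the value at [p1] counts, and there [h0] followed by [r0] returns to [p1]. *)
  apply: cset_eq => x; rewrite inE negbK inE => /eqP->.
  by rewrite pmulE h0p1 /= r0p3 ffunE inE eqxx.
pose h := [ffun x => Some (if x \in A then p1 else p2)] : ptrans V.
have pre1 : ppre h [set p1] = A.
  apply/setP=> x; rewrite !inE ffunE /= inE; case: (x \in A); rewrite ?eqxx //.
  by rewrite eq_sym (negbTE p12).
have pre2 : ppre h (~: [set p1]) = ~: A.
  apply/setP=> x; rewrite !inE ffunE /= !inE; case: (x \in A); rewrite ?eqxx //.
  by rewrite eq_sym p12.
have hf x : h x != None by rewrite ffunE.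
rewrite -{1}pre1 -{1}(full_z hf) -mulgA (mulgA (cset _)) -iota_cset !mulgA -gd.
rewrite -2!mulgA (mulgA d) dcz1 !mulgA gd -(mulgA d) iota_cset pre2.
rewrite -!mulgA -iotaM; congr (d * _); apply: cset_eq => x; rewrite inE negbK => xA.
by rewrite pmulE !ffunE xA /= ffunE inE eqxx.
Qed.

(** The empty map and the restriction [f] are both undefined at [p1], the only leaf that counts
    after [z]. *)
Lemma z_nowhere : z * iota (prestrict setT) = d * z.
Proof. by rewrite dz; apply: z_iota; rewrite !ffunE !inE eqxx. Qed.

Lemma restrict_cset U A :
  iota (prestrict U) * cset A = cset (A :\: U) * iota (prestrict U).
Proof. by rewrite iota_cset ppre_restrict. Qed.

(** * Normal forms of partial maps of the star on [option V], with centre [None] *)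

Definition lift0 g : ptrans (option V) :=
  [ffun x => if x is Some v then omap Some (g v) else Some None].
Lemma lift0E g w :
  lift0 g w = if w is Some v then omap Some (g v) else Some None.
Proof. by rewrite ffunE. Qed.

Definition lift_c : ptrans (option V) :=
  [ffun x => if x == Some p1 then Some None else Some x].
Definition lift_d : ptrans (option V) :=
  [ffun x => if x is Some _ then Some x else None].
Definition lift_z : ptrans (option V) :=
  [ffun x => Some (if x is None then Some p1 else None)].

Implicit Types al : ptrans (option V).

(** For [w], [None] means undefined, [Some None] the centre and [Some (Some k)] the leaf [k]. *)
Definition fibre al (w : option (option V)) : {set V} :=
  [set x | al (Some x) == w].
(** Leaves sent to the centre become undefined here; in [nform] the factor [cset] hides the values
    on them. *)
Definition off0 al : ptrans V := [ffun x => obind id (al (Some x))].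

Definition nform al : M :=
  match al None with
  | None => d * cset (fibre al (Some None)) * iota (off0 al)
  | Some None => cset (fibre al (Some None)) * iota (off0 al)
  | Some (Some k) => iota (prestrict (fibre al None))
      * cset (fibre al (Some (Some k))) * z * iota (pconst setT k)
  end.

(* The star condition when [None] is the centre *)
Definition admissible al := forall k x, al None = Some (Some k) ->
  al (Some x) \in [:: None; Some None; Some (Some k)].

(** Loose descriptions of [al]: [g] is arbitrary on [A], and [A] may overlap [U]. They allow the
    normal form of a product to be read off without computing its exact fibres. *)
Definition leaf_shape al A g := forall x,
  al (Some x) = if x \in A then Some None else omap Some (g x).
Definition centre_shape al U A k := forall x,
  al (Some x) = if x \in U then None else Some (if x \in A then Some k else None).

Lemma in_fibre al w x : (x \in fibre al w) = (al (Some x) == w).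
Proof. by rewrite inE. Qed.

Lemma leaf_shape_cset al A g : leaf_shape al A g ->
  cset A * iota g = cset (fibre al (Some None)) * iota (off0 al).
Proof.
move=> alE; have -> : fibre al (Some None) = A.
  by apply/setP=> x; rewrite in_fibre alE; case: (x \in A) => //; case: (g x).
by apply: cset_eq => x /negbTE xA; rewrite ffunE alE xA; case: (g x).
Qed.

Lemma nform_leaf al A g : al None = Some None -> leaf_shape al A g ->
  nform al = cset A * iota g.
Proof. by rewrite /nform => -> /leaf_shape_cset->. Qed.

Lemma nform_undef al A g : al None = None -> leaf_shape al A g ->
  nform al = d * cset A * iota g.
Proof. by rewrite /nform => -> /leaf_shape_cset; rewrite -!mulgA => ->. Qed.

Lemma nform_centre al U A k : al None = Some (Some k) -> centre_shape al U A k ->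
  nform al = iota (prestrict U) * cset A * z * iota (pconst setT k).
Proof.
rewrite /nform => -> alE; have -> : fibre al None = U.
  by apply/setP=> x; rewrite in_fibre alE; case: (x \in U).
have -> : fibre al (Some (Some k)) = A :\: U.
  apply/setP=> x; rewrite in_fibre inE alE; case: (x \in U) => //.
  by case: (x \in A) => //; rewrite eqxx.
by rewrite !restrict_cset setDDl setUid.
Qed.

Lemma leaf_shapeP al : leaf_shape al (fibre al (Some None)) (off0 al).
Proof. by move=> x; rewrite in_fibre ffunE; case: (al _) => [[y|]|]. Qed.

Lemma centre_shapeP al k : admissible al -> al None = Some (Some k) ->
  centre_shape al (fibre al None) (fibre al (Some (Some k))) k.
Proof.
move=> adm al0 x; have := adm _ x al0; rewrite !in_fibre !inE.
by case: (al _) => [[y|]|] //=; rewrite ?eqxx ?orbF //= => /eqP->; rewrite eqxx.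
Qed.

Lemma leaf_shape_lift0 al A g h : leaf_shape al A g ->
  leaf_shape (al * lift0 h) A (g * h).
Proof.
move=> alE x; rewrite !pmulE alE; case: ifP => //= _; first by rewrite ffunE.
by case: (g x) => //= y; rewrite ffunE.
Qed.

Lemma restrict_dcset_z U A : d * iota (prestrict U) * cset A * z =
  d * cset (~: (A :|: U)) * iota (prestrict U * pconst A p1).
Proof.
rewrite -gd -!mulgA (mulgA d) dcset_z !mulgA gd -!mulgA (mulgA (iota _)).
by rewrite restrict_cset setCU setDE -mulgA -iotaM.
Qed.

(** c_A d = f_A d turns the left side into a restriction, d and z, to which the formula for d c_A z
    applies with empty A. This serves the case in which the image of the centre leaves the
    domain. *)
Lemma centre_killed U A : iota (prestrict U) * cset A * (d * z) =
  d * cset (~: (U :|: A)) * iota (prestrict setT).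
Proof.
rewrite -!mulgA (mulgA (cset A)) csetd !mulgA -iotaM prestrictM gd.
have := restrict_dcset_z (U :|: A) set0; rewrite cset0 mulg1 set0U => ->.
congr (_ * iota _); apply/ffunP=> x; rewrite pmulE !ffunE in_setT.
by case: (x \in _); rewrite //= ffunE in_set0.
Qed.

(** * Right multiplication of normal forms by the generators *)

Lemma nform_iota al g : admissible al -> nform al * iota g = nform (al * lift0 g).
Proof.
move=> adm; have lsh := leaf_shape_lift0 g (leaf_shapeP al).
case al0: (al None) => [[k|]|].
- have sh := centre_shapeP adm al0; rewrite (nform_centre al0 sh) -mulgA -iotaM.
  move: (fibre al None) (fibre al (Some (Some k))) sh => U K sh.
  have be0 : (al * lift0 g) None = omap Some (g k) by rewrite pmulE al0 /= ffunE.
  case gk: (g k) be0 => [k'|] /= be0.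
    rewrite (@nform_centre _ U K k' be0) => [|x].
      by congr (_ * iota _); apply/ffunP=> x; rewrite pmulE !ffunE inE.
    rewrite pmulE sh; case: ifP => //= _; case: ifP => _ /=; rewrite ffunE //.
    by rewrite gk.
  (* [g] is undefined at [k]: the centre and the leaves over [k] drop out of the domain, while its
     other leaves stay at the centre. *)
  have -> : pconst setT k * g = prestrict setT.
    by apply/ffunP=> x; rewrite pmulE !ffunE inE.
  rewrite -mulgA z_nowhere centre_killed.
  rewrite (@nform_undef _ (~: (U :|: K)) (prestrict setT)) // => x.
  rewrite pmulE sh !inE [prestrict _ _]ffunE in_setT.
  by case: (x \in U) => /=; rewrite ?ffunE; case: (x \in K); rewrite /= ?gk.
- rewrite (nform_leaf al0 (leaf_shapeP al)) -mulgA -iotaM.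
  by rewrite (nform_leaf _ lsh) // pmulE al0 /= ffunE.
- rewrite (nform_undef al0 (leaf_shapeP al)) -mulgA -iotaM.
  by rewrite (nform_undef _ lsh) // pmulE al0.
Qed.

Lemma leaf_shape_c al A g : leaf_shape al A g ->
  leaf_shape (al * lift_c) (A :|: ppre g [set p1]) g.
Proof.
move=> alE x; rewrite pmulE alE !inE; case: (x \in A) => /=.
  by rewrite ffunE.
case: (g x) => //= y; rewrite inE ffunE.
by rewrite (inj_eq (@Some_inj _)).
Qed.

Lemma nform_c al : admissible al -> nform al * c = nform (al * lift_c).
Proof.
move=> adm; set A := fibre al (Some None); set g := off0 al.
have sh : leaf_shape al A g := leaf_shapeP al.
have shc := leaf_shape_c sh.
have E : cset A * iota g * c = cset (A :|: ppre g [set p1]) * iota g.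
  by rewrite -mulgA -cpt1 -cset1 iota_cset mulgA -csetU.
case al0: (al None) => [[k|]|].
- have {}sh := centre_shapeP adm al0; rewrite (nform_centre al0 sh).
  move: (fibre al None) (fibre al (Some (Some k))) sh => U K sh.
  have be0 : (al * lift_c) None = if k == p1 then Some None else Some (Some k).
    by rewrite pmulE al0 /= ffunE (inj_eq (@Some_inj _)).
  (* If [k] is [p1], then [c] brings the centre back to itself and the whole domain lands there. *)
  have [kp1|kp1] := eqVneq k p1.
    rewrite kp1 eqxx in be0.
    rewrite kp1 -(mulgA _ z) z_const -mulgA zc -mulgA -csetU setUT restrict_cset.
    rewrite (nform_leaf be0 (A := ~: U) (g := prestrict setT)) => [|x].
      rewrite setTD; apply: cset_eq => x; rewrite inE negbK => xU.
      by rewrite !ffunE xU inE.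
    rewrite pmulE sh !inE; case: (x \in U); rewrite /= !ffunE ?inE //.
    by case: (x \in K); rewrite ?kp1 ?eqxx.
  rewrite (negbTE kp1) in be0; rewrite (nform_centre be0 (U := U) (A := K)).
    rewrite -mulgA -cpt1 iota_cpt0 // => x; rewrite ffunE inE.
    by rewrite (inj_eq (@Some_inj _)).
  move=> x; rewrite pmulE sh; case: (x \in U) => //=; rewrite ffunE.
  by case: (x \in K) => //; rewrite (inj_eq (@Some_inj _)) (negbTE kp1).
- by rewrite (nform_leaf al0 sh) E (nform_leaf _ shc) // pmulE al0 /= ffunE.
- rewrite (nform_undef al0 sh) (nform_undef _ shc) -?mulgA ?(mulgA (cset A)) ?E //.
  by rewrite pmulE al0.
Qed.

Lemma nform_d al : admissible al -> nform al * d = nform (al * lift_d).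
Proof.
move=> adm; set A := fibre al (Some None); set g := off0 al.
have sh : leaf_shape al A g := leaf_shapeP al.
have shd : leaf_shape (al * lift_d) set0 (prestrict A * g).
  move=> x; rewrite !pmulE sh in_set0 [prestrict _ _]ffunE; case: (x \in A) => /=.
    by rewrite ffunE.
  by case: (g x) => //= y; rewrite ffunE.
have E : cset A * iota g * d = d * iota (prestrict A * g).
  by rewrite -mulgA gd mulgA csetd gd -mulgA iotaM.
case al0: (al None) => [[k|]|].
- have {}sh := centre_shapeP adm al0; rewrite (nform_centre al0 sh).
  move: (fibre al None) (fibre al (Some (Some k))) sh => U K sh.
  (* The leaves of the domain off [K] sit at the centre, so [d] removes them. *)
  rewrite (@nform_centre _ (U :|: ~: K) K k); first last.
  + move=> x; rewrite pmulE sh !inE; case: (x \in U) => //=.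
    by case: (x \in K); rewrite /= ffunE.
  + by rewrite pmulE al0 /= ffunE.
  rewrite -mulgA gd mulgA -(mulgA _ z) zd !mulgA; congr (_ * _ * _).
  rewrite -prestrictM iotaM -!mulgA; congr (_ * _).
  rewrite restrict_cset setDE setCK setIid; apply: cset_eq => x xK.
  by rewrite !ffunE !inE xK.
- rewrite (nform_leaf al0 sh) E (nform_undef _ shd) ?cset0 ?mulg1 //.
  by rewrite pmulE al0 /= ffunE.
- rewrite (nform_undef al0 sh) -!mulgA (mulgA (cset A)) E.
  rewrite (nform_undef _ shd) ?cset0 ?mulg1 ?mulgA ?dd //.
  by rewrite pmulE al0.
Qed.

Lemma nform_z al : admissible al -> nform al * z = nform (al * lift_z).
Proof.
move=> adm; move: (fibre al (Some None)) (off0 al) (leaf_shapeP al) => A g sh.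
(* [g] may be undefined at leaves of [A], which do lie in the domain; the undefined leaves are
   therefore [G :\: A]. *)
pose G := [set x | g x == None].
have E : cset A * iota g * z = iota (prestrict (G :\: A)) * cset A * z.
  rewrite -mulgA iota_z mulgA restrict_cset; congr (_ * _).
  have -> : A :\: (G :\: A) = A.
    by apply/setP=> x; rewrite !inE; case: (x \in A); rewrite ?andbF.
  by apply: cset_eq => x xA; rewrite !ffunE !inE xA.
case al0: (al None) => [[k|]|].
- have {}sh := centre_shapeP adm al0; rewrite (nform_centre al0 sh).
  move: (fibre al None) (fibre al (Some (Some k))) sh => U K sh.
  (* The constant map is absorbed and z z is a leaf map: the centre and the leaves over [k] end at
     the centre, the rest of the domain at [p1]. *)
  rewrite -mulgA full_z; last by move=> x; rewrite ffunE inE.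
  rewrite -mulgA zz restrict_cset -mulgA -iotaM.
  rewrite (@nform_leaf _ (K :\: U) (prestrict U * pconst setT p1)) //.
    by rewrite pmulE al0 /= ffunE.
  move=> x; rewrite !pmulE sh [prestrict _ _]ffunE in_setD.
  by case: (x \in U) => //=; case: (x \in K); rewrite /= !ffunE ?inE.
- rewrite (nform_leaf al0 sh) E (@nform_centre _ (G :\: A) A p1).
  + by rewrite -[RHS]mulgA z_const.
  + by rewrite pmulE al0 /= ffunE.
  move=> x; rewrite pmulE sh !inE; case: (x \in A); rewrite /= ?ffunE //.
  by case: (g x) => //= y; rewrite ffunE.
- rewrite (nform_undef al0 sh) -!mulgA (mulgA (cset A)) E !mulgA.
  rewrite restrict_dcset_z.
  rewrite (@nform_undef _ (~: (A :|: (G :\: A))) (prestrict (G :\: A) * pconst A p1)) //.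
    by rewrite pmulE al0.
  move=> x; rewrite !pmulE sh [prestrict _ _]ffunE !inE; case: ifP => xA /=.
    by rewrite !ffunE xA.
  by case: (g x) => //= y; rewrite ffunE.
Qed.

Lemma nform1 : nform 1 = 1.
Proof.
rewrite (@nform_leaf _ set0 1) ?cset0 ?iota1 ?mulg1 ?ponE // => x.
by rewrite !ponE inE.
Qed.

(** * Evaluation of normal forms *)

Variable ev : M -> ptrans (option V).
Hypothesis ev1 : ev 1 = 1.
Hypothesis evM : forall x y : M, ev (x * y) = ev x * ev y.
Hypothesis ev_iota : forall g, ev (iota g) = lift0 g.
Hypothesis ev_c : ev c = lift_c.
Hypothesis ev_d : ev d = lift_d.
Hypothesis ev_z : ev z = lift_z.

Lemma ev_cset A w : ev (cset A) w =
  Some (if w is Some x then if x \in A then None else Some x else None).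
Proof.
move: A; apply: cset_ind => [|i A IH].
  by rewrite cset0 ev1 ponE; case: w => // x; rewrite inE.
rewrite csetU cset1 /cset cpt_cseqC evM pmulE -/(cset A) IH.
rewrite !evM !ev_iota ev_c; case: w {IH} => [x|] /=; last first.
  by rewrite !pmulE ffunE /= ffunE /= ffunE.
rewrite !inE; case: (x \in A); first by rewrite orbT !pmulE ffunE /= ffunE /= ffunE.
rewrite !pmulE ffunE /= ffunE /= ffunE (inj_eq (@Some_inj _)) orbF.
rewrite (canF_eq (tpermK p1 i)) tpermL; case: eqP => //= _; first by rewrite ffunE.
by rewrite lift0E /= ffunE /= tpermK.
Qed.

(** A homomorphism with the expected values on [iota g], [c], [d], [z] recovers [al] from its normal
    form; this will show that evaluation is onto. *)
Lemma ev_nform al : admissible al -> ev (nform al) = al.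
Proof.
move=> adm; apply/ffunP=> w; have lsh := leaf_shapeP al.
have leafE A g : ev (cset A * iota g) w =
    if w is Some x then if x \in A then Some None else omap Some (g x) else Some None.
  rewrite evM pmulE ev_cset ev_iota /= ffunE.
  by case: w => // x; case: (x \in A).
case al0: (al None) => [[k|]|].
- have sh := centre_shapeP adm al0; rewrite (nform_centre al0 sh).
  rewrite !evM !ev_iota ev_z !pmulE !lift0E.
  case: w {leafE} => [x|] /=; last first.
    by rewrite ev_cset /= !ffunE /= !ffunE inE.
  rewrite sh [prestrict _ _]ffunE; case: (x \in _) => //=.
  by rewrite ev_cset; case: (x \in fibre al _); rewrite /= !ffunE //= ?ffunE ?inE.
- rewrite (nform_leaf al0 lsh) leafE; by case: w {leafE} => [x|] //; rewrite lsh.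
- rewrite (nform_undef al0 lsh) -mulgA evM ev_d pmulE ffunE.
  by case: w leafE => [x|] leafE //=; rewrite leafE lsh.
Qed.

End NormalForm.

(** * The generators of PT(V) *)

Section Cycles.
Variable m : nat.
Local Notation V := 'I_m.+3.
Implicit Types (x y : V).

(** The cycle (k, k+1, ..., m+2), fixing everything below [k]. On the leaves, [k = 0] gives b_0 and
    [k = 1] gives b_0a_0. *)
Definition cycle_fun (k x : V) : V :=
  if x < k then x else if x == ord_max then k else inord x.+1.

Lemma val_cycle_fun (k x : V) : cycle_fun k x = 
  (if x < k then x : nat else if x == m.+2 :> nat then k : nat else x.+1) :> nat.
Proof.
rewrite /cycle_fun -val_eqE /=; case: (x < k) => //.
by case: eqP => // xm; rewrite inordK //; have := ltn_ord x; lia.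
Qed.

Lemma cycle_fun_inj (k : V) : injective (cycle_fun k).
Proof.
move=> x y /(congr1 val) /=; rewrite !val_cycle_fun => xy; apply: val_inj.
move: xy; have := ltn_ord x; have := ltn_ord y; have := ltn_ord k => /=.
by case: (ltnP x k); case: (ltnP y k); do ?case: eqP; lia.
Qed.

Definition cycle_from k : {perm V} := perm (@cycle_fun_inj k).

Lemma val_cycle_from (k x : V) : cycle_from k x =
  (if x < k then x : nat else if x == m.+2 :> nat then k : nat else x.+1) :> nat.
Proof. by rewrite permE val_cycle_fun. Qed.

(** Conjugating by the cycle moves (k, k+1) to every adjacent transposition above [k]; conjugating
    by these gives all (k, i), and then (i, j) is (k, i) conjugated by (k, j). *)
Lemma tperm_cycle_gen (k : V) (Q : ptrans V -> Prop) : k < m.+2 ->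
    Q 1 -> (forall g h, Q g -> Q h -> Q (g * h)) ->
    Q (pperm (cycle_from k)) -> Q (pperm (tperm k (inord k.+1))) ->
  forall i j : V, k <= i -> k <= j -> Q (pperm (tperm i j)).
Proof.
move=> km Q1 QM Qc Qt.
have QX p e : Q (pperm p) -> Q (pperm (p ^+ e)).
  by move=> Qp; elim: e => [|e IH]; rewrite ?pperm1 // expgS ppermM; apply: (QM).
(* [Q] is only closed under products; an inverse is available as a power of the permutation. *)
have QJ p q : Q (pperm p) -> Q (pperm q) -> Q (pperm (p ^ q)).
  move=> Qp Qq; rewrite conjgE !ppermM; apply: (QM) => //; last exact: QM.
  by rewrite invg_expg; apply: QX.
have adj e : k + e < m.+2 -> Q (pperm (tperm (inord (k + e)) (inord (k + e).+1))).
  elim: e => [|e IH] em; first by rewrite addn0 inord_val.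
  have cE t : k <= t < m.+2 -> cycle_from k (inord t) = inord t.+1.
    by move=> ?; apply: val_inj; rewrite /= val_cycle_from !inordK; do ?case: ifP; lia.
  rewrite addnS -cE ?[X in tperm _ X]cE; try lia.
  rewrite -[inord (k + e).+2]cE; last lia.
  by rewrite -tpermJ; apply: QJ => //; apply: IH; lia.
have first_tp e : k + e <= m.+2 -> Q (pperm (tperm k (inord (k + e)))).
  elim: e => [|[|e] IH] em; first by rewrite addn0 inord_val tperm1 pperm1.
    by rewrite addn1.
  have := QJ _ _ (IH ltac:(lia)) (adj e.+1 ltac:(lia)).
  rewrite tpermJ tpermL -addnS tpermD //; apply/eqP=> /(congr1 val) /=.
    by rewrite inordK; lia.
  by rewrite inordK; lia.
have tk (i : V) : k <= i -> Q (pperm (tperm k i)).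
  move=> ki; have -> : i = inord (k + (i - k)) by rewrite subnKC // inord_val.
  by apply: first_tp; rewrite subnKC //; have := ltn_ord i; lia.
move=> i j ki kj; have [->|ij] := eqVneq i j; first by rewrite tperm1 pperm1.
have [<-|kj'] := eqVneq k j; first by rewrite tpermC; apply: tk.
have := QJ _ _ (tk i ki) (tk j kj); rewrite tpermJ tpermL.
have [<-|ki'] := eqVneq k i; first by move=> _; apply: tk.
by rewrite tpermD 1?tpermC // eq_sym.
Qed.

End Cycles.

(** * The letters a_0, b_0, e_0, f_0 as maps of the leaves *)

Section Generators.
Variable m : nat.
Local Notation V := 'I_m.+3.
Local Notation n := m.+4.
Local Notation i0 := (ord0 : V).
Local Notation i1 := (inord 1 : V).
Local Notation i2 := (inord 2 : V).
Implicit Types (g h : ptrans V) (x y : V).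

(** The leaf [i + 1] of the star is the ordinal [i], so [i0], [i1], [i2] are the leaves 1, 2, 3. *)
Definition leaf_gen0 (x : letter0) : ptrans V :=
  match x with
  | A0 => pperm (tperm i0 i1)
  | B0 => pperm (cycle_from i0)
  | E0 => pcollapse i1 i0
  | F0 => prestrict [set i0]
  end.

Local Notation A := (leaf_gen0 A0).
Local Notation B := (leaf_gen0 B0).
Local Notation E := (leaf_gen0 E0).
Local Notation F := (leaf_gen0 F0).

Lemma val_i1 : i1 = 1%N :> nat. Proof. by rewrite inordK. Qed.
Lemma val_i2 : i2 = 2 :> nat. Proof. by rewrite inordK. Qed.

Lemma i01 : i0 != i1. Proof. by rewrite -val_eqE /= val_i1. Qed.
Lemma i02 : i0 != i2. Proof. by rewrite -val_eqE /= val_i2. Qed.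
Lemma i12 : i1 != i2. Proof. by rewrite -val_eqE /= val_i1 val_i2. Qed.

Lemma leafBE x : exists2 y : V, B x = Some y &
  y = (if x == m.+2 :> nat then 0 else x.+1) :> nat.
Proof. by exists (cycle_from i0 x); rewrite ?ffunE // val_cycle_from. Qed.

Lemma leafB_max : B ord_max = Some i0.
Proof. by rewrite ffunE; congr Some; apply: val_inj; rewrite /= val_cycle_from /= eqxx. Qed.

Lemma leafB_order : B ^+ m.+3 = 1.
Proof.
rewrite -ppermX -pperm1; congr pperm; apply/permP=> x; rewrite perm1; apply: val_inj.
have H k : k <= m.+3 -> (cycle_from i0 ^+ k) x =
    (if x + k <= m.+2 then x + k else x + k - m.+3) :> nat.
  elim: k => [|k IH] km; first by rewrite expg0 perm1 addn0 -ltnS ltn_ord.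
  rewrite expgSr permM val_cycle_from /= (IH (ltnW km)).
  by have := ltn_ord x; do ?case: ifP; lia.
by rewrite /= H //; have := ltn_ord x; case: ifP; lia.
Qed.

Lemma leafBK : B * B ^+ m.+2 = 1.
Proof. by rewrite -expgS leafB_order. Qed.

Lemma leafBVK : B ^+ m.+2 * B = 1.
Proof. by rewrite -expgSr leafB_order. Qed.

(** [B ^+ m.+2], that is b_0^{n-2}, inverts [B], so this is a conjugate of [A]. This word and those
    of [leafBA], [leafAFA], [leafABABEBABA] are the ones that R_w makes commute with c_0. *)
Lemma leafBAB : B ^+ m.+2 * A * B = pperm (tperm i1 i2).
Proof.
have J : tperm i1 i2 = tperm i0 i1 ^ cycle_from i0.
  rewrite tpermJ; congr tperm; apply: val_inj.
    by rewrite /= val_cycle_from val_i1.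
  by rewrite /= val_cycle_from val_i1 val_i2.
have -> : pperm (tperm i1 i2) = B ^+ m.+2 * (B * pperm (tperm i1 i2)).
  by rewrite mulgA leafBVK mul1g.
by rewrite -mulgA J conjgE; congr (_ * _); rewrite -!ppermM mulVKg.
Qed.

Lemma leafBA : B * A = pperm (cycle_from i1).
Proof.
rewrite -ppermM; congr pperm; apply/permP=> x; rewrite permM.
apply: val_inj; rewrite /= val_cycle_from val_i1; have := val_cycle_from i0 x.
have := ltn_ord x; case: tpermP => [->|->|/eqP + /eqP]; rewrite -?val_eqE /= ?val_i1 /=.
- by do ?case: ifP; lia.
- by do ?case: ifP; lia.
- by do ?case: ifP; lia.
Qed.

Lemma leafAFA : A * F * A = prestrict [set i1].
Proof. by have := prestrictJ (tperm i0 i1) i0; rewrite tpermL tpermV. Qed.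

Lemma leafABABEBABA :
  A * B ^+ m.+2 * A * B * E * B ^+ m.+2 * A * B * A = pcollapse i2 i1.
Proof.
move: (B ^+ m.+2) leafBAB => T BAB.
have -> : A * T * A * B * E * T * A * B * A =
    A * (T * A * B) * E * (T * A * B) * A by rewrite !mulgA.
(* [p] takes [i1] to [i2] and [i0] to [i1], so it conjugates [E] to the wanted collapse. *)
rewrite BAB; pose p := tperm i1 i2 * tperm i0 i1.
have p1 : p i1 = i2.
  by rewrite permM tpermL tpermD // ?i02 ?i12.
have p0 : p i0 = i1.
  by rewrite permM (tpermD (z := i0)) ?tpermL // 1?eq_sym ?i01 ?i02.
by have := pcollapseJ p i1 i0; rewrite p1 p0 => <-; rewrite /p invMg !tpermV !ppermM !mulgA.
Qed.

(** A round sends 0 and 1 to 1 and moves larger points up by one, the top one to 0; a point that has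
    come down to at most 1 stays there. *)
Lemma leafEB x : forall k, exists2 y : V, ((E * B) ^+ k) x = Some y &
  y <= 1 \/ 2 <= x /\ y = x + k :> nat.
Proof.
elim=> [|k [y IH yP]].
  by exists x; rewrite ?expg0 ?ponE // addn0; case: (leqP 2 x); [right|left]; lia.
have [t Bt tE] := leafBE (if y == i1 then i0 else y).
exists t; first by rewrite expgSr pmulE IH /= pmulE ffunE.
move: tE; have := ltn_ord y.
case: (y =P i1) => [->|/eqP]; rewrite -?val_eqE /= ?val_i1; first by lia.
by case: ifP; lia.
Qed.

Lemma leafEBE : (E * B) ^+ m.+1 * E = pconst setT i0.
Proof.
apply/ffunP=> x; have [y yE yP] := leafEB x m.+1.
rewrite pmulE yE /= !ffunE inE; congr Some; case: (y =P i1) => // /eqP.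
rewrite -val_eqE /= val_i1 => y1; apply: val_inj => /=; have := ltn_ord y; lia.
Qed.

(** Under rounds of [B * E], 0 stays put and any other point climbs until it passes the top and
    falls to 0 for good. After [m.+1] rounds only the point 1 has not fallen: it is at the top. [A]
    in front exchanges it with 0. *)
Lemma leafABE x : (A * (B * E) ^+ m.+1) x = Some (if x == i0 then ord_max else i0).
Proof.
have H (t : V) k : exists2 y : V, ((B * E) ^+ k) t = Some y &
  y = (if (0 < t) && (t + k <= m.+2) then t + k else 0) :> nat.
  elim: k => [|k [y IH yP]].
    by exists t; rewrite ?expg0 ?ponE //; have := ltn_ord t; case: ifP; lia.
  have [u Bu uE] := leafBE y.
  exists (if u == i1 then i0 else u).
    by rewrite expgSr pmulE IH /= pmulE Bu /= ffunE.
  move: uE; rewrite yP; case: (u =P i1) => [->|/eqP]; rewrite -?val_eqE /= ?val_i1.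
    by do ?case: ifP; lia.
  by do ?case: ifP; lia.
rewrite pmulE ffunE /=; have [y -> yE] := H (tperm i0 i1 x) m.+1; congr Some.
apply: val_inj; rewrite /= yE; have := ltn_ord x.
case: tpermP => [->|->|/eqP x0 /eqP]; rewrite ?eqxx /= ?val_i1 //=.
- by case: ifP; lia.
- by rewrite eq_sym (negbTE i01).
by rewrite (negbTE x0) -val_eqE /= val_i1; move: x0; rewrite -val_eqE /=; case: ifP; lia.
Qed.

(** Each round deletes the point standing at 0 and advances the others cyclically, so [m.+3] rounds
    delete everything. *)
Lemma leafFB : (F * B) ^+ m.+3 = prestrict setT.
Proof.
apply/ffunP=> x; rewrite [RHS]ffunE inE.
have H k y : ((F * B) ^+ k) x = Some y ->
    (0 < k -> 0 < x) /\ (y = x + k :> nat \/ y = 0 :> nat /\ x + k = m.+3).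
  elim: k y => [|k IH] y; first by rewrite expg0 ponE => -[<-]; rewrite addn0; split; [|left].
  rewrite expgSr pmulE; case tE: (_ x) => [t|] //=; have := IH t tE.
  rewrite pmulE ffunE inE; case: (t =P i0) => //= /eqP; rewrite -val_eqE /= => t0.
  have [y' -> yE] := leafBE t => tP -[yy']; move: yE tP; rewrite -yy'.
  by have := ltn_ord t; case: ifP; lia.
by case xE: (_ x) => [y|//]; have := H _ _ xE; have := ltn_ord y; lia.
Qed.

Definition leaf_eval (w : seq letter0) : ptrans V := \prod_(x <- w) leaf_gen0 x.

Lemma leaf_evalM u v : leaf_eval (u ++ v) = leaf_eval u * leaf_eval v.
Proof. by rewrite /leaf_eval big_cat. Qed.

Lemma leaf_eval1 (x : letter0) : leaf_eval [:: x] = leaf_gen0 x.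
Proof. by rewrite /leaf_eval big_seq1. Qed.

(** Stated with boolean equality so that [xchoose] can pick a word for [g]. *)
Lemma leaf_eval_surj g : exists w, leaf_eval w == g.
Proof.
pose Q h := exists w, leaf_eval w == h; rewrite -/(Q g).
have Q1 : Q 1 by exists [::]; rewrite /leaf_eval big_nil.
have QM h h' : Q h -> Q h' -> Q (h * h').
  by move=> [u /eqP<-] [v /eqP<-]; exists (u ++ v); rewrite leaf_evalM.
have Qg (x : letter0) : Q (leaf_gen0 x) by exists [:: x]; rewrite leaf_eval1.
apply: (@pmul_closed_genJ _ setT Q i0 i1 _ _ i01 Q1 QM _ (Qg E0) (Qg F0)).
- by rewrite inE.
- by rewrite inE.
- move=> i j _ _; apply: (tperm_cycle_gen _ Q1 QM (Qg B0) (Qg A0)) => //.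
- by move=> x; rewrite inE.
by move=> x y _ _; rewrite inE.
Qed.

(* A letter as a transformation of [option V], [None] being the centre *)
Definition opt_gen (x : letter) : ptrans (option V) :=
  match x with
  | Old y => lift0 (leaf_gen0 y)
  | C0 => lift_c i0 | D => lift_d V | Z => lift_z i0
  end.

(** * Transport between the vertices in ['I_n] and [option V] *)

Definition of_opt (w : option V) : 'I_n := oapp (lift ord0) ord0 w.

Definition to_opt (s : ptrans 'I_n) : ptrans (option V) :=
  [ffun w => omap (unlift ord0) (s (of_opt w))].

Lemma of_optK : cancel of_opt (unlift ord0).
Proof. by case=> [v|]; rewrite /of_opt /= ?liftK ?unlift_none. Qed.

Lemma unliftK : cancel (unlift ord0) of_opt.
Proof. by move=> i; case: unliftP => [j ->|->]. Qed.

Lemma to_optM : {morph to_opt : s t / s * t}.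
Proof.
move=> s t; apply/ffunP=> w; rewrite !ffunE.
by case: (s _) => //= i; rewrite ffunE unliftK.
Qed.

Lemma to_opt1 : to_opt 1 = 1.
Proof. by apply/ffunP=> w; rewrite !ffunE /= of_optK. Qed.

Lemma to_opt_inj : injective to_opt.
Proof.
move=> s t /ffunP st; apply/ffunP=> i; have := st (unlift ord0 i).
by rewrite !ffunE unliftK => /(inj_omap (can_inj unliftK)).
Qed.

Lemma to_opt_fullMap (h : nat -> nat) (r : option V -> option V) :
  (forall w, h (of_opt w) = of_opt (r w) :> nat) ->
  to_opt (fullMap n h) = [ffun w => Some (r w)].
Proof.
by move=> hr; apply/ffunP=> w; rewrite !ffunE hr valK /= of_optK.
Qed.

Lemma lift0_perm (p : {perm V}) :
  lift0 (pperm p) = [ffun w => Some (omap p w)].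
Proof. by apply/ffunP=> -[x|]; rewrite !ffunE /= ?ffunE. Qed.

Lemma val_of_opt w : of_opt w = oapp (fun v : V => v.+1) 0 w :> nat.
Proof. by case: w. Qed.

Lemma to_opt_genTrans (x : letter) : to_opt (genTrans n x) = opt_gen x.
Proof.
case: x => [[]|||] /=.
- rewrite lift0_perm; apply: to_opt_fullMap => -[x|] //.
  rewrite !val_of_opt /=; case: tpermP => [->|->|/eqP + /eqP]; rewrite -?val_eqE /= ?val_i1 //.
  by case: x => [[|[|x]]] //= _; rewrite val_i1.
- rewrite lift0_perm; apply: to_opt_fullMap => -[x|] //.
  by rewrite !val_of_opt /= val_cycle_from /=; case: ifP; case: ifP; lia.
- have -> : lift0 (pcollapse i1 i0) =
      [ffun w => Some (omap (fun x => if x == i1 then i0 else x) w)].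
    by apply/ffunP=> -[x|]; rewrite !ffunE /= ?ffunE.
  apply: to_opt_fullMap => -[x|] //; rewrite !val_of_opt /= -val_eqE /= val_i1.
  by case: x => [[|[|x]]].
- apply/ffunP=> -[x|]; rewrite !ffunE /= ?ffunE ?inE; last first.
    by rewrite -[LHS]/(Some _) unlift_none.
  rewrite -val_eqE /= /bump leq0n add1n eqSS.
  by case: (nat_of_ord x == 0); rewrite /= ?liftK.
- have -> : lift_c i0 = [ffun w => Some (if w == Some i0 then None else w)].
    by apply/ffunP=> w; rewrite !ffunE; case: (w == _).
  apply: to_opt_fullMap => -[x|] //; rewrite !val_of_opt (inj_eq (@Some_inj _)) -val_eqE /=.
  by case: x => [[|x]].
- apply/ffunP=> -[x|]; rewrite !ffunE //=.
  by rewrite liftK.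
- by apply: to_opt_fullMap => -[x|].
Qed.

End Generators.

(** * Soundness of the relations *)

Section Soundness.
Variable m : nat.
Local Notation V := 'I_m.+3.
Local Notation n := m.+4.
Local Notation i0 := (ord0 : V).
Local Notation i1 := (inord 1 : V).
Local Notation i2 := (inord 2 : V).
Local Notation gen := (@leaf_gen0 m).
Implicit Types (g h : ptrans V) (x y : V).

Definition opt_eval (w : seq letter) : ptrans (option V) := \prod_(x <- w) opt_gen m x.

Lemma lift0M g h : lift0 (g * h) = lift0 g * lift0 h.
Proof.
apply/ffunP=> w; rewrite pmulE !lift0E; case: w => [x|] //=; last by rewrite lift0E.
by rewrite pmulE; case: (g x) => //= y; rewrite lift0E.
Qed.

Lemma lift01 : lift0 (1 : ptrans V) = 1.
Proof. by apply/ffunP=> -[x|]; rewrite lift0E !ponE. Qed.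

Lemma lift0X g k : lift0 (g ^+ k) = lift0 g ^+ k.
Proof. by elim: k => [|k IH]; rewrite ?lift01 // !expgS lift0M IH. Qed.

Lemma lift0_inj : injective (@lift0 V).
Proof.
move=> g h /ffunP gh; apply/ffunP=> x; have := gh (Some x).
by rewrite !lift0E => /(inj_omap (@Some_inj _)).
Qed.

Lemma opt_evalM u v : opt_eval (u ++ v) = opt_eval u * opt_eval v.
Proof. by rewrite /opt_eval big_cat. Qed.

Lemma opt_eval1 (x : letter) : opt_eval (letterWord x) = opt_gen m x.
Proof. by rewrite /opt_eval big_seq1. Qed.

Lemma opt_evalX (u : freeMonoid letter) k : opt_eval (u ^+ k) = opt_eval u ^+ k.
Proof.
elim: k => [|k IH]; first by rewrite !expg0 /opt_eval big_nil.
by rewrite !expgS opt_evalM IH.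
Qed.

Lemma opt_eval_old w : opt_eval (map Old w) = lift0 (leaf_eval m w).
Proof.
elim: w => [|x w IH]; first by rewrite /opt_eval /leaf_eval !big_nil lift01.
by rewrite -cat1s leaf_evalM map_cat opt_evalM IH lift0M opt_eval1 leaf_eval1.
Qed.

Lemma to_opt_eval0 w : to_opt (eval0 n w) = lift0 (leaf_eval m w).
Proof.
rewrite /eval0; elim: w => [|x w IH].
  by rewrite /leaf_eval !big_nil to_opt1 lift01.
rewrite -cat1s leaf_evalM big_cons to_optM IH lift0M leaf_eval1; congr (_ * _).
exact: (to_opt_genTrans m (Old x)).
Qed.

(** Lets the hypothesis on R_0 be read on the leaves alone: R_0 presents the monoid of partial maps
    of [V]. *)
Lemma eval0_leaf_eval u v : eval0 n u = eval0 n v <-> leaf_eval m u = leaf_eval m v.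
Proof.
split=> [uv|uv]; first by apply: lift0_inj; rewrite -!to_opt_eval0 uv.
by apply: to_opt_inj; rewrite !to_opt_eval0 uv.
Qed.

Lemma lift_c_stab g : g i0 = Some i0 -> (forall x, g x = Some i0 -> x = i0) ->
  lift_c i0 * lift0 g = lift0 g * lift_c i0.
Proof.
move=> g0 gx; apply/ffunP=> w; rewrite !pmulE lift0E ffunE.
case: w => [x|] /=; last by rewrite lift0E ffunE.
rewrite (inj_eq (@Some_inj _)); case: eqP => [->|x0] /=.
  by rewrite g0 /= lift0E ffunE eqxx.
rewrite lift0E; case gxy: (g x) => [y|] //=; rewrite ffunE (inj_eq (@Some_inj _)).
by case: eqP => // y0; case: x0; apply: gx; rewrite gxy y0.
Qed.

Lemma lift_cE w : lift_c i0 w = Some (if w == Some i0 then None else w).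
Proof. by rewrite ffunE; case: (w == _). Qed.

Lemma lift_dE w : lift_d V w = if w is Some _ then Some w else None.
Proof. by rewrite ffunE. Qed.

Lemma lift_zE w : lift_z i0 w = Some (if w is None then Some i0 else None).
Proof. by rewrite ffunE. Qed.

Definition lift_simp := (lift_cE, lift_dE, lift_zE, @pmulE, @lift0E).

Lemma lift0_d g : lift0 g * lift_d V = lift_d V * lift0 g.
Proof.
apply/ffunP=> -[x|]; rewrite !pmulE lift0E ffunE //= ?lift0E ?ffunE //.
by case: (g x) => //= y; rewrite ffunE.
Qed.

Lemma lift0_z g : (forall x, g x != None) -> lift0 g * lift_z i0 = lift_z i0.
Proof.
move=> gT; apply/ffunP=> -[x|]; rewrite !pmulE lift0E [RHS]ffunE /= ?ffunE //.
by have := gT x; case: (g x) => //= y; rewrite ffunE.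
Qed.

Lemma leaf_gen0_full (x : letter0) : x != F0 -> forall v, gen x v != None.
Proof. by case: x => // _ v; rewrite ffunE. Qed.

Variable R0 : relations letter0.
Hypothesis hR0 : forall u v, cong R0 u v <-> eval0 n u = eval0 n v.

(** Gathers adjacent leaf letters under one [lift0], so that the identities between leaf maps can be
    rewritten inside. *)
Ltac evalE k1E k2E k3E :=
  rewrite -?k1E -?k2E -?k3E !(opt_evalX, opt_evalM, opt_eval1) /opt_gen
    -?mulgA -?(lift0X, lift0M) ?mulgA -?lift0M.

Lemma opt_eval_Rw u v : Rw n R0 u v -> opt_eval u = opt_eval v.
Proof.
(* The exponents are made opaque: a power with exponent [n - 2] would unfold
   into products under rewriting with [mulgA]. *)
have [k1 k1E] : exists k, k = n.-1 by exists n.-1.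
have [k2 k2E] : exists k, k = n - 2 by exists (n - 2).
have [k3 k3E] : exists k, k = n - 3 by exists (n - 3).
case=> [{u v}_ _ [u v uv||||||||||||]||||||||||||].
- rewrite !opt_eval_old; congr lift0; apply/eval0_leaf_eval/hR0.
  exact: cong_rel.
all: evalE k1E k2E k3E.
- by rewrite expg2; apply/ffunP=> -[x|]; rewrite pmulE ffunE //= ffunE.
- exact: lift0_d.
- exact: lift0_d.
- exact: lift0_d.
- exact: lift0_d.
- exact/lift0_z/leaf_gen0_full.
- exact/lift0_z/leaf_gen0_full.
- exact/lift0_z/leaf_gen0_full.
- apply/ffunP=> -[x|]; rewrite !lift_simp /= ?lift_simp //=.
  by rewrite ffunE inE eqxx.
- rewrite k1E leafFB; apply/ffunP=> -[x|]; rewrite !lift_simp /= ?lift_simp //.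
  by rewrite ffunE inE.
- rewrite k3E leafEBE expg2; apply/ffunP=> -[x|]; rewrite !lift_simp /= ?lift_simp //.
  by rewrite ffunE inE.
- rewrite k1E leafFB; apply/ffunP=> -[x|]; rewrite !lift_simp /= ?lift_simp //.
  by rewrite ffunE inE.
- rewrite expg2; apply/ffunP=> w; rewrite !lift_simp /= lift_simp.
  by case wi: (w == _); rewrite ?wi.
- apply/ffunP=> -[x|]; rewrite !lift_simp /= ?lift_simp /= ?lift_simp //.
  rewrite ffunE /= lift_simp !(inj_eq (@Some_inj _)).
  case: (x =P i0) => [->|/eqP x0]; rewrite /= ?lift_simp ?(negbTE (i01 m)) ?eqxx //=.
  rewrite ffunE /= lift_simp !(inj_eq (@Some_inj _)).
  case: (x =P i1) => [->|/eqP x1]; first by rewrite tpermR eqxx.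
  by rewrite tpermD ?(negbTE x0) // eq_sym.
- apply/ffunP=> w; rewrite !lift_simp /= lift_simp.
  case: w => [x|] //=; rewrite (inj_eq (@Some_inj _)); case: (x =P i0) => //= /eqP x0.
  by rewrite ffunE inE (negbTE x0).
- apply/ffunP=> -[x|]; rewrite !lift_simp /= ?lift_simp // ffunE inE.
  by case: eqP => //= /eqP x0; rewrite lift_simp (inj_eq (@Some_inj _)) (negbTE x0).
- apply/ffunP=> -[x|]; rewrite !lift_simp /= ?lift_simp // ffunE inE (inj_eq (@Some_inj _)).
  by case: eqP => //= x0; rewrite lift_simp.
(* In this and the next three relations the leaf map fixes the first leaf and sends no other leaf to
   it, so it commutes with c_0. *)
- rewrite k2E leafBAB; apply: lift_c_stab => [|x]; rewrite ffunE.
    by rewrite tpermD // eq_sym ?i01 ?i02.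
  by move=> [] /(canRL (tpermK _ _))->; rewrite tpermD // eq_sym ?i01 ?i02.
- rewrite leafBA; apply: lift_c_stab => [|x]; rewrite ffunE.
    by congr Some; apply: val_inj; rewrite /= val_cycle_from val_i1.
  move=> [] /(congr1 val) /=; rewrite val_cycle_from val_i1 => H; apply: val_inj => /=.
  by move: H; do ?case: ifP; lia.
- rewrite leafAFA; apply: lift_c_stab => [|x]; rewrite ffunE inE ?(negbTE (i01 m)) //.
  by case: ifP => // _ [].
- rewrite k2E leafABABEBABA.
  apply: lift_c_stab => [|x]; rewrite ffunE; first by rewrite (negbTE (i02 m)).
  by case: (x =P i2) => [_ [] /eqP|_ [] //]; rewrite eq_sym (negbTE (i01 m)).
- apply/ffunP=> -[x|]; rewrite !lift_simp /= ?lift_simp /= ?lift_simp ?eqxx //.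
  by case: (Some x == Some i0); rewrite ?eqxx.
- by apply/ffunP=> -[x|]; rewrite !lift_simp /= ?lift_simp /= ?lift_simp ?eqxx.
- have -> : k3 = m.+1 by rewrite k3E.
  (* Being inverse to b_0, the power b_0^{n-2} sends the first leaf to the last. *)
  have g1E : (gen B0 ^+ k2) i0 = Some ord_max.
    have /ffunP/(_ ord_max) := leafBK m.
    by rewrite pmulE leafB_max ponE k2E.
  have := @leafABE m; move: (gen A0 * _) (gen B0 ^+ _) g1E => g0 g1 g1E g0E.
  apply/ffunP=> -[x|]; rewrite !lift_simp //= !lift_simp // g0E /=.
  rewrite !lift_simp /= !lift_simp !(inj_eq (@Some_inj _)).
  by case: (x == i0); rewrite /= ?g1E.
Qed.

End Soundness.

(** * The presented monoid *)

Section Presented.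
Variable m : nat.
Local Notation V := 'I_m.+3.
Local Notation n := m.+4.
Local Notation i0 := (ord0 : V).
Local Notation i1 := (inord 1 : V).
Local Notation i2 := (inord 2 : V).
Local Notation gen := (@leaf_gen0 m).
Implicit Types (g h : ptrans V) (x y : V).
Variable R0 : relations letter0.
Hypothesis hR0 : forall u v, cong R0 u v <-> eval0 n u = eval0 n v.

Local Notation M := (presented (Rw n R0)).
Definition cl (u : freeMonoid letter) : M := presentedClass (Rw n R0) u.

Lemma clM (u v : freeMonoid letter) : cl (u * v) = cl u * cl v.
Proof. by rewrite /cl -presentedMulE. Qed.

Lemma clX (u : freeMonoid letter) k : cl (u ^+ k) = cl u ^+ k.
Proof. by elim: k => [|k IH] //; rewrite !expgS clM IH. Qed.

Lemma cl_rel u v : Rw n R0 u v -> cl u = cl v.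
Proof. by move=> uv; apply/presentedClassP/cong_rel. Qed.

Lemma cong_old u v : cong R0 u v -> cong (Rw n R0) (map Old u) (map Old v).
Proof.
elim=> [{}u {}v uv|{}u|{}u {}v _|{}u {}v w _ uv _ vw|{}u u' {}v v' _ uv _ vw].
- exact/cong_rel/Rw_Rs/Rs_R0.
- exact: cong_refl.
- exact: cong_sym.
- exact: cong_trans vw.
- by rewrite !map_cat; apply: cong_mul.
Qed.

Definition leaf_word g : seq letter0 := xchoose (leaf_eval_surj g).

Lemma leaf_wordK g : leaf_eval m (leaf_word g) = g.
Proof. exact/eqP/(xchooseP (leaf_eval_surj g)). Qed.

Definition leaf_class g : M := cl (map Old (leaf_word g)).

(** Words with the same leaf map are already congruent under R_0, so the chosen word is immaterial;
    multiplicativity of [leaf_class] follows. *)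
Lemma cl_old w : cl (map Old w) = leaf_class (leaf_eval m w).
Proof.
apply/presentedClassP/cong_old/hR0/eval0_leaf_eval.
by rewrite leaf_wordK.
Qed.

Lemma leaf_class1 : leaf_class 1 = 1.
Proof. by have := cl_old [::]; rewrite /leaf_eval big_nil. Qed.

Lemma leaf_classM g h : leaf_class (g * h) = leaf_class g * leaf_class h.
Proof. by rewrite -clM -{1}(leaf_wordK g) -{1}(leaf_wordK h) -leaf_evalM -cl_old map_cat. Qed.

Lemma leaf_classX g k : leaf_class (g ^+ k) = leaf_class g ^+ k.
Proof. by elim: k => [|k IH]; rewrite ?leaf_class1 // !expgS leaf_classM IH. Qed.

Definition letter_class (x : letter) : M :=
  match x with Old y => leaf_class (gen y) | x => cl (letterWord x) end.

Lemma cl_letter (x : letter) : cl (letterWord x) = letter_class x.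
Proof. by case: x => // y; rewrite /= -leaf_eval1 -cl_old. Qed.

(** * The hypotheses on normal forms, checked in the presented monoid *)

Local Notation cc := (cl (letterWord C0)).
Local Notation dd := (cl (letterWord D)).
Local Notation zz := (cl (letterWord Z)).
Local Notation iota := leaf_class.

(** Brings in a relation of R_w as an equation between classes, its leaf letters gathered into
    [leaf_class]; exponents are hidden meanwhile so that powers do not unfold. *)
Ltac foldR r :=
  have := cl_rel (r : Rw n R0 _ _);
  let e1 := fresh "e1" in let e2 := fresh "e2" in let e3 := fresh "e3" in
  (have [? e1] : exists k, k = n.-1 by exists n.-1);
  (have [? e2] : exists k, k = n - 2 by exists (n - 2));
  (have [? e3] : exists k, k = n - 3 by exists (n - 3));
  rewrite -?e1 -?e2 -?e3 !(clX, clM, cl_letter) /letter_class -?mulgA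
    -?(leaf_classX, leaf_classM) ?mulgA -?leaf_classM ?e1 ?e2 ?e3.

(** Four relations of R_w make c_0 commute with a cycle, a transposition, a restriction and a
    collapse on the leaves other than the first. These generate all maps that fix [i0] and preserve
    its complement. *)
Lemma cl_c_stab g : g i0 = Some i0 -> (forall x, g x = Some i0 -> x = i0) ->
  iota g * cc = cc * iota g.
Proof.
pose Q h := iota h * cc = cc * iota h.
have Q1 : Q 1 by rewrite /Q leaf_class1 mul1g mulg1.
have QM h h' : Q h -> Q h' -> Q (h * h').
  by rewrite /Q leaf_classM => qh qh'; rewrite -mulgA qh' !mulgA qh.
have Qc : Q (pperm (cycle_from i1)).
  by rewrite -leafBA; foldR (Rw_cba n R0).
have Qt : Q (pperm (tperm i1 (inord (i1 : V).+1))).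
  by rewrite val_i1 -leafBAB; foldR (Rw_cbab n R0).
have Qf : Q (prestrict [set i1]).
  by rewrite -leafAFA; foldR (Rw_cafa n R0).
have Qe : Q (pcollapse i2 i1).
  by foldR (Rw_cabab n R0); rewrite leafABABEBABA.
move=> g0 gx; apply: (@pmul_closed_genJ _ (~: [set i0]) Q i1 i2 _ _ _ Q1 QM _ Qe Qf).
- by rewrite !inE eq_sym i01.
- by rewrite !inE eq_sym i02.
- exact: i12.
- move=> i j; rewrite !inE -!lt0n => ii jj.
  by apply: (tperm_cycle_gen _ Q1 QM Qc Qt); rewrite val_i1.
- by move=> x; rewrite !inE negbK => /eqP->.
move=> x y; rewrite !inE => x0 gxy; apply: contra x0 => /eqP y0.
by apply/eqP/gx; rewrite gxy y0.
Qed.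

Lemma cl_ec : iota (pcollapse i1 i0) * cc = cc * iota (pperm (tperm i0 i1)) * cc.
Proof. by foldR (Rw_ec n R0). Qed.

Lemma cl_cc : cc * cc = cc.
Proof. by foldR (Rw_cc n R0). Qed.

Lemma cl_cf : cc * iota (prestrict [set i0]) = cc.
Proof. by foldR (Rw_cf n R0). Qed.

Lemma cl_fc : iota (prestrict [set i0]) * cc = iota (prestrict [set i0]).
Proof. by foldR (Rw_fc n R0). Qed.

Lemma cl_cd : cc * dd = iota (prestrict [set i0]) * dd.
Proof. by foldR (Rw_cd n R0). Qed.

Lemma cl_dd : dd * dd = dd.
Proof. by foldR (Rw_Rs (Rs_dd n R0)). Qed.

Lemma cl_gd g : iota g * dd = dd * iota g.
Proof.
have gend (x : letter0) : iota (gen x) * dd = dd * iota (gen x).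
  case: x.
  - by foldR (Rw_Rs (Rs_ad n R0)).
  - by foldR (Rw_Rs (Rs_bd n R0)).
  - by foldR (Rw_Rs (Rs_ed n R0)).
  - by foldR (Rw_Rs (Rs_fd n R0)).
rewrite -(leaf_wordK g); elim: (leaf_word g) => [|x w IH].
  by rewrite /leaf_eval big_nil leaf_class1 mul1g mulg1.
by rewrite -cat1s leaf_evalM leaf_eval1 leaf_classM -mulgA IH mulgA gend mulgA.
Qed.

Lemma cl_zz : zz * zz = iota (pconst setT i0).
Proof. by rewrite -leafEBE; foldR (Rw_Rs (Rs_zz n R0)). Qed.

(** The constant map is (e_0b_0)^{n-3}e_0, whose letters z absorbs one after another. *)
Lemma cl_kz : iota (pconst setT i0) * zz = zz.
Proof.
have ez : iota (gen E0) * zz = zz by foldR (Rw_Rs (Rs_ez n R0)).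
have bz : iota (gen B0) * zz = zz by foldR (Rw_Rs (Rs_bz n R0)).
have ebz k : (iota (gen E0) * iota (gen B0)) ^+ k * zz = zz.
  by elim: k => [|k IH]; rewrite ?expg0 ?mul1g // expgSr -!mulgA bz ez.
by rewrite -leafEBE leaf_classM -mulgA ez leaf_classX leaf_classM ebz.
Qed.

Lemma cl_dz : dd * zz = zz * iota (prestrict [set i0]).
Proof. by foldR (Rw_Rs (Rs_dz n R0)). Qed.

Lemma cl_zd : zz * dd = iota (prestrict setT) * zz.
Proof. by rewrite -leafFB; foldR (Rw_Rs (Rs_zd n R0)). Qed.

Lemma cl_zzc : zz * zz * cc = zz * cc.
Proof. by foldR (Rw_zzc n R0). Qed.

(** The last relation of R_w, multiplied on the right by b_0 to cancel b_0^{n-2}. *)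
Lemma cl_dcz : dd * cc * zz =
  iota (gen A0 * (gen B0 * gen E0) ^+ m.+1) * dd * cc * iota (gen B0).
Proof.
have E : dd * cc * zz * iota (gen B0 ^+ m.+2) =
    iota (gen A0 * (gen B0 * gen E0) ^+ m.+1) * dd * cc.
  by foldR (Rw_dczb n R0).
by rewrite -E -[RHS]mulgA -leaf_classM leafBVK leaf_class1 mulg1.
Qed.

(** * The isomorphism with PwEnd(S_n) *)

Definition class_nform (al : ptrans (option V)) : M := nform i0 iota cc dd zz al.

Lemma class_nform1 : class_nform 1 = 1.
Proof.
exact: (nform1 (i01 m) _ _ leaf_class1 leaf_classM cl_c_stab cl_ec cl_cc cl_cf).
Qed.

Lemma class_nformM al (x : letter) : admissible al ->
  class_nform al * cl (letterWord x) = class_nform (al * opt_gen m x).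
Proof.
move=> adm.
have p13 : i0 != ord_max by [].
pose h0 : ptrans V := gen A0 * (gen B0 * gen E0) ^+ m.+1.
have h0p1 : h0 i0 = Some ord_max by rewrite leafABE eqxx.
have h0D y : y != i0 -> h0 y = Some i0 by rewrite leafABE => /negbTE->.
case: x => [y|||]; rewrite /opt_gen.
- rewrite cl_letter.
  exact: (nform_iota (i01 m) leaf_class1 leaf_classM cl_c_stab cl_ec cl_cc cl_cf
    cl_fc cl_cd cl_gd cl_kz cl_zz cl_dz p13 h0p1 h0D (leafB_max m) cl_dcz).
- exact: (nform_c (i01 m) _ leaf_class1 leaf_classM cl_c_stab cl_ec cl_cc cl_cf
    cl_fc cl_kz cl_zz cl_zzc).
- exact: (nform_d (i01 m) leaf_class1 leaf_classM cl_c_stab cl_ec cl_cc cl_cf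
    cl_fc cl_cd cl_dd cl_gd cl_zd).
- exact: (nform_z (i01 m) leaf_class1 leaf_classM cl_c_stab cl_ec cl_cc cl_cf
    cl_fc cl_gd cl_kz cl_zz p13 h0p1 h0D (leafB_max m) cl_dcz).
Qed.

Definition pw_eval (w : seq letter) : PwEnd (star n) := \prod_(x <- w) genPwEnd n x.

Lemma pw_evalK w : to_opt (pwval (pw_eval w)) = opt_eval m w.
Proof.
rewrite /pw_eval /opt_eval; elim: w => [|x w IH]; first by rewrite !big_nil to_opt1.
rewrite !big_cons -IH -to_opt_genTrans -to_optM; congr to_opt.
Qed.

(** If the centre goes to a leaf, each leaf of the domain, being adjacent to the centre, must go to
    that leaf or to a neighbour of it, and the only neighbour is the centre. *)
Lemma admissible_pwEnd (s : PwEnd (star n)) : admissible (to_opt (pwval s)).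
Proof.
case: s => s /pwEndoP sP k x /=; rewrite !ffunE /of_opt /=.
case s0: (s ord0) => [k'|] //= [kE].
have {}kE : k' = lift ord0 k by rewrite -[LHS]unliftK kE.
case sx: (s _) => [y|] //=; rewrite !inE /=.
have := sP ord0 _ _ _ s0 sx; case: unliftP => [y' ->|_ _]; last by rewrite eqxx.
have [ky|ky] := eqVneq k y'; first by rewrite ky eqxx orbT.
move=> /(_ isT); rewrite kE => H; case: (notF (H _)) => /lift_inj/eqP.
by rewrite (negbTE ky).
Qed.

(** Induction on the last letter, by right multiplication of normal forms; each prefix evaluates to
    a weak endomorphism and so is admissible. Hence words with equal evaluation are congruent. *)
Lemma class_nform_eval w : class_nform (opt_eval m w) = cl w.
Proof.
elim/last_ind: w => [|w x IH]; first by rewrite /opt_eval big_nil class_nform1.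
have -> : opt_eval m (rcons w x) = opt_eval m w * opt_gen m x.
  by rewrite -cats1 opt_evalM opt_eval1.
rewrite -class_nformM ?IH -?clM; last by rewrite -pw_evalK; apply: admissible_pwEnd.
by congr cl; rewrite -cats1.
Qed.

Lemma cong_pw_eval u v : cong (Rw n R0) u v -> pw_eval u = pw_eval v.
Proof.
move=> uv; apply/val_inj/to_opt_inj; rewrite /= !pw_evalK.
elim: uv => [{}u {}v|//|{}u {}v _ ->//|{}u {}v w _ -> _ ->//|{}u u' {}v v' _ Eu _ Ev].
  exact: opt_eval_Rw.
by rewrite !opt_evalM Eu Ev.
Qed.

Definition class_eval (p : M) : PwEnd (star n) := pw_eval (generic_quotient.repr p).

Lemma class_evalE u : class_eval (cl u) = pw_eval u.
Proof.
by apply/cong_pw_eval/presentedClassP; rewrite /presentedClass generic_quotient.reprK.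
Qed.

Lemma class_eval_morphism : monoid_morphism class_eval.
Proof.
split=> [|p q]; first by rewrite (class_evalE [::]) /pw_eval big_nil.
have [u ->] := presentedClass_surj p; have [v ->] := presentedClass_surj q.
by rewrite -!/(cl _) -clM !class_evalE /pw_eval big_cat.
Qed.

HB.instance Definition _ :=
  isUMagmaMorphism.Build M (PwEnd (star n)) class_eval class_eval_morphism.

Lemma class_evalK : cancel class_eval (fun s => class_nform (to_opt (pwval s))).
Proof.
move=> p; have [u ->] := presentedClass_surj p.
by rewrite -/(cl u) class_evalE pw_evalK class_nform_eval.
Qed.

Lemma class_nformK : cancel (fun s => class_nform (to_opt (pwval s))) class_eval.
Proof.
move=> s; apply/val_inj/to_opt_inj => /=.
pose ev p := to_opt (pwval (class_eval p)).
have evE u : ev (cl u) = opt_eval m u by rewrite /ev class_evalE pw_evalK.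
have ev1 : ev 1 = 1 by rewrite (evE [::]) /opt_eval big_nil.
have evM p q : ev (p * q) = ev p * ev q.
  by rewrite /ev class_eval_morphism.2 -to_optM.
have ev_iota g : ev (iota g) = lift0 g by rewrite evE opt_eval_old leaf_wordK.
apply: (ev_nform (i01 m) leaf_class1 leaf_classM cl_c_stab cl_ec cl_cc cl_cf cl_fc
  (ev := ev) ev1 evM ev_iota); rewrite ?evE ?opt_eval1 //.
exact: admissible_pwEnd.
Qed.

Lemma presented_star : presentationDefines (Rw n R0) (genPwEnd n).
Proof.
exists class_eval; split; first exact: Bijective class_evalK class_nformK.
by move=> x; rewrite /= class_evalE /pw_eval big_seq1.
Qed.

End Presented.

(** The bound 4 provides three leaves: with only two, b_0^{n-2}a_0b_0 is the transposition of the
    leaves 1 and 2, which does not commute with c_0. *)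
Theorem theorem6p5 (n : nat) (hn : 4 <= n) (R0 : relations letter0)
    (hR0 : forall u v : freeMonoid letter0,
             cong R0 u v <-> eval0 n u = eval0 n v) :
  presentationDefines (Rw n R0) (genPwEnd n).
Proof. by case: n hn hR0 => [|[|[|[|m]]]] // _; apply: presented_star. Qed.
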